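(* Let $0<\lambda<1$ and $0<p<1$, and let $\mathbb{D}=\{z:|z|<1\}$. A function $f$ belongs to the class $\mathcal{U}_m(\lambda)$ (with pole at $p$) and has a simple pole at the point $z=p$ if and only if there exists a function $\omega$ analytic in $\mathbb{D}$ with $|\omega(z)|\le 1$ for all $z\in\mathbb{D}$ such that \[ f(z)=\frac{z}{1-\frac{z}{p}+\lambda z\int_z^p\omega(t)\,dt},\quad z\in\mathbb{D}. \]
   Context: For $\lambda\in(0,1)$ and $p\in(0,1)$, $\mathcal{U}_m(\lambda)$ denotes the family of functions $f$ meromorphic in $\mathbb{D}$ with a pole at the point $z=p$, having a Taylor expansion $f(z)=z+\sum_{k=2}^\infty a_k z^k$ for $|z|<p$, and satisfying $|U_f(z)|<\lambda$ for every $z\in\mathbb{D}$, where $U_f(z)=\frac{z}{f(z)}-z\left(\frac{z}{f(z)}\right)'-1$. The integral $\int_z^p\omega(t)\,dt$ is taken along any path in $\mathbb{D}$ from $z$ to $p$. *)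

(* Defs.v *)
From Stdlib Require Import Reals.
From Coquelicot Require Export Coquelicot.
Open Scope C_scope.

Definition inD (z : C) : Prop := (Cmod z < 1)%R.

Definition has_cderiv (h : C -> C) (z l : C) : Prop :=
  @is_derive C_AbsRing C_NormedModule h z l.

Definition holo_on (S : C -> Prop) (h : C -> C) : Prop :=
  forall z, S z -> exists l, has_cderiv h z l.

(* Integral of w from z to q along the straight segment t = z + s (q - z),
   s in [0,1] (a path in D when z, q are in D). *)
Definition seg_int (w : C -> C) (z q : C) : C :=
  @RInt C_R_CompleteNormedModule
    (fun s : R => w (z + RtoC s * (q - z)) * (q - z)) 0%R 1%R.

Definition has_pole_at (f : C -> C) (q : C) : Prop :=
  forall M : R, exists d : R, (0 < d)%R /\
    forall z, (0 < Cmod (z - q) < d)%R -> (M < Cmod (f z))%R.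

Definition has_simple_pole_at (f : C -> C) (q : C) : Prop :=
  exists c : C, c <> 0 /\
    forall eps : R, (0 < eps)%R -> exists d : R, (0 < d)%R /\
      forall z, (0 < Cmod (z - q) < d)%R -> (Cmod ((z - q) * f z - c) < eps)%R.

(* The class U_m(lambda) with pole at p:
   - f meromorphic in D: holomorphic on D \ {p}, with a pole at p;
   - Taylor expansion f z = z + sum_{k>=2} a_k z^k for |z| < p;
   - z/f(z) is (extends to) an analytic function g on D (g z * f z = z off p),
     and |U_f(z)| = |g z - z g'(z) - 1| < lambda for every z in D. *)
Definition in_Um (lam p : R) (f : C -> C) : Prop :=
  holo_on (fun z => inD z /\ z <> RtoC p) f /\
  has_pole_at f (RtoC p) /\
  (exists a : nat -> C, a 0%nat = 0 /\ a 1%nat = 1 /\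
     forall z, (Cmod z < p)%R -> is_series (fun k => a k * Cpow z k) (f z)) /\
  (exists g g' : C -> C,
     (forall z, inD z -> has_cderiv g z (g' z)) /\
     (forall z, inD z -> z <> RtoC p -> g z * f z = z) /\
     (forall z, inD z -> (Cmod (g z - z * g' z - 1) < lam)%R)).

(* Main.v *)
Require Import Defs.
From Stdlib Require Import Reals Lra Lia.
From Coquelicot Require Import Coquelicot.
Open Scope C_scope.

(** With [g z = z / f z], the relation [U_f z = g z - z g' z - 1] says that [U_f = - z^2 k'],
    where [k z = (g z - 1) / z] is analytic because [g 0 = 1].  Put [w = - k' / lam]: the
    maximum principle on circles of radius tending to 1 turns [|U_f| < lam] into [|w| <= 1],
    and integrating [k'] from [z] to [p], where a pole of [f] forces [g p = 0], gives the
    formula.  Conversely, the denominator [g] of the formula satisfies [U_f = lam z^2 w]; it has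
    no zero in the disc other than [p], because [g z = 0] means
    [p - z = - lam p z int_z^p w], whose right-hand side is smaller than [|p - z|].

    The analysis rests on Taylor's theorem for functions that are merely complex differentiable,
    obtained from Goursat's bisection argument applied to the images of rectangles under
    [(t, s) |-> z0 + t (r e^(i s) - z0)]. *)

(** Why power series are needed at all: the hypothesis gives [g'] only as a pointwise derivative,
    while [w] is a multiple of [k'] and must itself be differentiable, so [k] needs two derivatives.
    Conversely, a primitive of [w] is needed before the segment integral can be differentiated in
    its lower endpoint.

    The bound on [k'] is Schwarz's lemma for a double zero: pointwise, [|U_f| < lam] only gives
    [|k'| < lam / |z|^2], useless near 0, and the maximum principle carries the good bound inwards
    from circles close to the boundary.

    The parametrisation by [t] and [s] is chosen because the edges [s = 0] and [s = 2 PI] of the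
    parameter rectangle have the same image and cancel, so Goursat's theorem directly compares two
    circles, without winding numbers. Deforming towards [z0] gives Cauchy's formula; deforming
    towards 0 shows that the Taylor coefficients do not depend on the radius.

    In the converse direction the pole must also be shown to be simple; this is [g' p <> 0], and
    follows from [lam p^2 < 1]. *)

Lemma nested_intervals (u v : nat -> R) :
  (forall n, u n <= u (S n))%R -> (forall n, v (S n) <= v n)%R ->
  (forall n, u n <= v n)%R -> exists x, forall n, (u n <= x <= v n)%R.
Proof.
  intros Hu Hv Huv.
  assert (Mu : forall n k, (u n <= u (n + k)%nat)%R).
  { intros n; induction k as [|k IH]; [rewrite Nat.add_0_r; lra|].
    rewrite Nat.add_succ_r. specialize (Hu (n + k)%nat). lra. }
  assert (Mv : forall n k, (v (n + k)%nat <= v n)%R).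
  { intros n; induction k as [|k IH]; [rewrite Nat.add_0_r; lra|].
    rewrite Nat.add_succ_r. specialize (Hv (n + k)%nat). lra. }
  assert (Hub : forall n m, (u n <= v m)%R).
  { intros n m. pose proof (Mu n m). pose proof (Mv m n).
    rewrite (Nat.add_comm m n) in H0. specialize (Huv (n + m)%nat). lra. }
  destruct (completeness (fun x => exists n, x = u n)) as [x [Hx1 Hx2]].
  - exists (v O). intros y [n ->]. apply Hub.
  - exists (u O). now exists O.
  - exists x. intros n. split.
    + apply Hx1. now exists n.
    + apply Hx2. intros y [m ->]. apply Hub.
Qed.

(** * Bisection for additive functions of rectangles *)

Section RectangleBisection.

Variable Phi : R -> R -> R -> R -> C.
Variables a b c d : R.
Hypothesis Hab : (a <= b)%R.
Hypothesis Hcd : (c <= d)%R.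
Hypothesis Phi_split_l : forall t1 t t2 s1 s2,
  (a <= t1 <= t)%R -> (t <= t2 <= b)%R -> (c <= s1 <= s2)%R -> (s2 <= d)%R ->
  Phi t1 t2 s1 s2 = Phi t1 t s1 s2 + Phi t t2 s1 s2.
Hypothesis Phi_split_r : forall t1 t2 s1 s s2,
  (a <= t1 <= t2)%R -> (t2 <= b)%R -> (c <= s1 <= s)%R -> (s <= s2 <= d)%R ->
  Phi t1 t2 s1 s2 = Phi t1 t2 s1 s + Phi t1 t2 s s2.
Hypothesis Phi_small : forall x y, (a <= x <= b)%R -> (c <= y <= d)%R ->
  forall eps, (0 < eps)%R -> exists del, (0 < del)%R /\
  forall t1 t2 s1 s2,
  (a <= t1 <= x)%R -> (x <= t2 <= b)%R -> (c <= s1 <= y)%R -> (y <= s2 <= d)%R ->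
  (t2 - t1 < del)%R -> (s2 - s1 < del)%R ->
  (Cmod (Phi t1 t2 s1 s2) <= eps * ((t2 - t1) + (s2 - s1)) ^ 2)%R.

Let rect := ((R * R) * (R * R))%type.
Let val (r : rect) := Cmod (Phi (fst (fst r)) (snd (fst r)) (fst (snd r)) (snd (snd r))).

(** The half that is kept carries at least half of the modulus: if the first half fails the test,
    additivity and the triangle inequality make the second one pass. *)
Let halve_l (r : rect) : rect :=
  let '((t1, t2), (s1, s2)) := r in
  let m := ((t1 + t2) / 2)%R in
  if Rle_dec (val r / 2) (val ((t1, m), (s1, s2)))
  then ((t1, m), (s1, s2)) else ((m, t2), (s1, s2)).

Let halve_r (r : rect) : rect :=
  let '((t1, t2), (s1, s2)) := r in
  let m := ((s1 + s2) / 2)%R in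
  if Rle_dec (val r / 2) (val ((t1, t2), (s1, m)))
  then ((t1, t2), (s1, m)) else ((t1, t2), (m, s2)).

Let valid (r : rect) :=
  (a <= fst (fst r) <= snd (fst r) /\ snd (fst r) <= b /\
   c <= fst (snd r) <= snd (snd r) /\ snd (snd r) <= d)%R.

Lemma halve_l_spec r : valid r ->
  valid (halve_l r) /\ (val r / 2 <= val (halve_l r))%R /\
  (fst (fst r) <= fst (fst (halve_l r)))%R /\
  (snd (fst (halve_l r)) <= snd (fst r))%R /\
  (snd (fst (halve_l r)) - fst (fst (halve_l r)) = (snd (fst r) - fst (fst r)) / 2)%R /\
  snd (halve_l r) = snd r.
Proof.
  destruct r as [[t1 t2] [s1 s2]]. intros (H1 & H2 & H3 & H4). simpl in *.
  unfold halve_l. destruct Rle_dec as [Hle|Hnle]; unfold valid; simpl.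
  - repeat split; lra.
  - assert (val ((t1, t2), (s1, s2)) <= val ((t1, (t1 + t2) / 2), (s1, s2))
        + val (((t1 + t2) / 2, t2), (s1, s2)))%R.
    { unfold val; simpl. rewrite (Phi_split_l t1 ((t1 + t2) / 2)%R t2); try lra.
      apply Cmod_triangle. }
    repeat split; lra.
Qed.

Lemma halve_r_spec r : valid r ->
  valid (halve_r r) /\ (val r / 2 <= val (halve_r r))%R /\
  (fst (snd r) <= fst (snd (halve_r r)))%R /\
  (snd (snd (halve_r r)) <= snd (snd r))%R /\
  (snd (snd (halve_r r)) - fst (snd (halve_r r)) = (snd (snd r) - fst (snd r)) / 2)%R /\
  fst (halve_r r) = fst r.
Proof.
  destruct r as [[t1 t2] [s1 s2]]. intros (H1 & H2 & H3 & H4). simpl in *.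
  unfold halve_r. destruct Rle_dec as [Hle|Hnle]; unfold valid; simpl.
  - repeat split; lra.
  - assert (val ((t1, t2), (s1, s2)) <= val ((t1, t2), (s1, (s1 + s2) / 2))
        + val ((t1, t2), ((s1 + s2) / 2, s2)))%R.
    { unfold val; simpl. rewrite (Phi_split_r t1 t2 s1 ((s1 + s2) / 2)%R s2); try lra.
      apply Cmod_triangle. }
    repeat split; lra.
Qed.

Let sub (n : nat) : rect := Nat.iter n (fun r => halve_r (halve_l r)) ((a, b), (c, d)).

Lemma sub_valid n : valid (sub n).
Proof.
  induction n as [|n IH].
  - unfold valid; simpl; lra.
  - simpl. apply halve_r_spec, halve_l_spec, IH.
Qed.

Lemma sub_step n :
  (val (sub n) / 4 <= val (sub (S n)))%R /\
  (fst (fst (sub n)) <= fst (fst (sub (S n))))%R /\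
  (snd (fst (sub (S n))) <= snd (fst (sub n)))%R /\
  (fst (snd (sub n)) <= fst (snd (sub (S n))))%R /\
  (snd (snd (sub (S n))) <= snd (snd (sub n)))%R /\
  (snd (fst (sub (S n))) - fst (fst (sub (S n))) =
     (snd (fst (sub n)) - fst (fst (sub n))) / 2)%R /\
  (snd (snd (sub (S n))) - fst (snd (sub (S n))) =
     (snd (snd (sub n)) - fst (snd (sub n))) / 2)%R.
Proof.
  pose proof (halve_l_spec _ (sub_valid n)) as (V & A1 & A2 & A3 & A4 & A5).
  pose proof (halve_r_spec _ V) as (_ & B1 & B2 & B3 & B4 & B5).
  change (sub (S n)) with (halve_r (halve_l (sub n))).
  rewrite B5, A5 in *. repeat split; lra.
Qed.

(** A round of two halvings costs a factor of at most 4 in the modulus and gains exactly 4 in the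
    squared half-perimeter. [Phi_small] at the common point of the nested rectangles therefore
    bounds [Phi a b c d] by an arbitrarily small multiple of [D ^ 2]. *)
Lemma additive_rectangle_zero : Phi a b c d = 0.
Proof.
  apply Cmod_eq_0.
  destruct (Rle_lt_or_eq_dec 0 _ (Cmod_ge_0 (Phi a b c d))) as [Hpos|]; [exfalso|auto].
  destruct (nested_intervals (fun n => fst (fst (sub n))) (fun n => snd (fst (sub n))))
    as [x Hx]; try (intros n; apply sub_step).
  { intros n. apply sub_valid. }
  destruct (nested_intervals (fun n => fst (snd (sub n))) (fun n => snd (snd (sub n))))
    as [y Hy]; try (intros n; apply sub_step).
  { intros n. apply sub_valid. }
  simpl in Hx, Hy.
  assert (Hw : forall n, (snd (fst (sub n)) - fst (fst (sub n)) = (b - a) * (/ 2) ^ n)%R /\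
     (snd (snd (sub n)) - fst (snd (sub n)) = (d - c) * (/ 2) ^ n)%R /\
     (Cmod (Phi a b c d) * (/ 4) ^ n <= val (sub n))%R).
  { induction n as [|n (I1 & I2 & I3)].
    - unfold val; simpl. lra.
    - pose proof (sub_step n) as (S1 & _ & _ & _ & _ & S2 & S3).
      rewrite S2, S3, I1, I2. simpl pow. repeat split; try lra. }
  set (D := ((b - a) + (d - c))%R).
  assert (HD : (0 <= D)%R) by (unfold D; lra).
  (* With this [eps] the final bound is [D ^ 2 / (D ^ 2 + 1)] times the modulus, hence strictly
     smaller; the [+ 1] also covers a rectangle degenerate to a point. *)
  assert (He : (0 < Cmod (Phi a b c d) / (D ^ 2 + 1))%R).
  { apply Rdiv_lt_0_compat; nra. }
  destruct (Phi_small x y (Hx O) (Hy O) (Cmod (Phi a b c d) / (D ^ 2 + 1))%R He)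
    as [del [Hdel HP]].
  destruct (pow_lt_1_zero (/ 2) ltac:(rewrite Rabs_pos_eq; lra) (del / (D + 1))%R)
    as [N HN].
  { apply Rdiv_lt_0_compat; lra. }
  specialize (HN N (le_n N)).
  rewrite Rabs_pos_eq in HN by (apply pow_le; lra).
  destruct (Hw N) as (W1 & W2 & W3).
  pose proof (sub_valid N) as (V1 & V2 & V3 & V4).
  specialize (Hx N). specialize (Hy N).
  assert (Hh : (0 < (/ 2) ^ N)%R) by (apply pow_lt; lra).
  assert (HN' : ((/ 2) ^ N * (D + 1) < del)%R).
  { apply (Rmult_lt_compat_r (D + 1)) in HN; [|lra].
    replace (del / (D + 1) * (D + 1))%R with del in HN by (field; lra). lra. }
  specialize (HP (fst (fst (sub N))) (snd (fst (sub N))) (fst (snd (sub N))) (snd (snd (sub N)))).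
  fold (val (sub N)) in HP.
  rewrite W1, W2 in HP.
  assert (HP' : (val (sub N) <= Cmod (Phi a b c d) / (D ^ 2 + 1) *
       ((b - a) * (/ 2) ^ N + (d - c) * (/ 2) ^ N) ^ 2)%R).
  { unfold D in HN'. apply HP; try lra; nra. }
  replace ((b - a) * (/ 2) ^ N + (d - c) * (/ 2) ^ N)%R with (D * (/ 2) ^ N)%R in HP'
    by (unfold D; ring).
  replace ((/ 4) ^ N)%R with (((/ 2) ^ N) ^ 2)%R in W3.
  2:{ rewrite <- pow_mult, Nat.mul_comm, pow_mult. f_equal. field. }
  set (h := ((/ 2) ^ N)%R) in *.
  assert (Heq : (Cmod (Phi a b c d) / (D ^ 2 + 1) * (D * h) ^ 2 =
    Cmod (Phi a b c d) * h ^ 2 - Cmod (Phi a b c d) / (D ^ 2 + 1) * h ^ 2)%R).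
  { field. nra. }
  assert (0 < Cmod (Phi a b c d) / (D ^ 2 + 1) * h ^ 2)%R.
  { apply Rmult_lt_0_compat; [lra|nra]. }
  lra.
Qed.

End RectangleBisection.

(** * Limits and derivatives in terms of the modulus *)

(** One calculus of limits for full and punctured neighbourhoods in [C], neighbourhoods in [R] and
    sequences. Using [Cmod] hides that [C] is a normed module both over itself and over [R]. *)
Definition ctends {T : Type} (F : (T -> Prop) -> Prop) (f : T -> C) (l : C) : Prop :=
  forall eps : R, (0 < eps)%R -> F (fun x => (Cmod (f x - l) < eps)%R).

Definition cnbhs (z : C) (P : C -> Prop) : Prop :=
  exists d : R, (0 < d)%R /\ forall y, (Cmod (y - z) < d)%R -> P y.

Lemma Cmod_minus_sym (x y : C) : Cmod (x - y) = Cmod (y - x).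
Proof. rewrite <- Cmod_opp. f_equal. ring. Qed.

Lemma Cmod_triangle_rev (x y : C) : (Cmod x - Cmod y <= Cmod (x - y))%R.
Proof.
  pose proof (Cmod_triangle (x - y) y) as H.
  replace (x - y + y) with x in H by ring. lra.
Qed.

Lemma Cmod_minus_le (x y : C) : (Cmod (x - y) <= Cmod x + Cmod y)%R.
Proof. rewrite <- (Cmod_opp y). apply Cmod_triangle. Qed.

Lemma Cmod_minus_self (z : C) : Cmod (z - z) = 0%R.
Proof. replace (z - z) with (RtoC 0) by ring. apply Cmod_0. Qed.

#[export] Instance cnbhs_filter (z : C) : Filter (cnbhs z).
Proof.
  split.
  - exists 1%R. split; [lra|auto].
  - intros P Q [d [Hd HP]] [e [He HQ]]. exists (Rmin d e). split.
    + now apply Rmin_glb_lt.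
    + intros y Hy. split; [apply HP|apply HQ];
      (eapply Rlt_le_trans; [exact Hy|]); [apply Rmin_l|apply Rmin_r].
  - intros P Q H [d [Hd HP]]. exists d; auto.
Qed.

Lemma cnbhs_disc (z : C) (r : R) : (Cmod z < r)%R -> cnbhs z (fun y => (Cmod y < r)%R).
Proof.
  intros H. exists (r - Cmod z)%R. split; [lra|].
  intros y Hy. pose proof (Cmod_triangle_rev y z). lra.
Qed.

Lemma cnbhs_neq (z w : C) : z <> w -> cnbhs z (fun y => y <> w).
Proof.
  intros H. exists (Cmod (z - w)). split.
  - apply Cmod_gt_0. now apply Cminus_eq_contra.
  - intros y Hy ->. rewrite Cmod_minus_sym in Hy. lra.
Qed.

Section Tends.

Context {T : Type} {F : (T -> Prop) -> Prop} {FF : Filter F}.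

Lemma ctends_const (c : C) : ctends F (fun _ => c) c.
Proof.
  intros eps He. apply filter_forall. intros _. now rewrite Cmod_minus_self.
Qed.

Lemma ctends_ext (f g : T -> C) (l : C) :
  F (fun x => f x = g x) -> ctends F f l -> ctends F g l.
Proof.
  intros H Hf eps He. specialize (Hf eps He).
  generalize (filter_and _ _ H Hf). apply filter_imp. now intros x [-> ?].
Qed.

Lemma ctends_plus (f g : T -> C) (l m : C) :
  ctends F f l -> ctends F g m -> ctends F (fun x => f x + g x) (l + m).
Proof.
  intros Hf Hg eps He.
  assert (He2 : (0 < eps / 2)%R) by lra.
  generalize (filter_and _ _ (Hf _ He2) (Hg _ He2)).
  apply filter_imp. intros x [H1 H2].
  replace (f x + g x - (l + m)) with ((f x - l) + (g x - m)) by ring.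
  eapply Rle_lt_trans; [apply Cmod_triangle|lra].
Qed.

Lemma ctends_mult (f g : T -> C) (l m : C) :
  ctends F f l -> ctends F g m -> ctends F (fun x => f x * g x) (l * m).
Proof.
  intros Hf Hg eps He.
  pose proof (Cmod_ge_0 l). pose proof (Cmod_ge_0 m).
  set (K := (Cmod l + Cmod m + 1)%R).
  assert (HK : (0 < K)%R) by (unfold K; lra).
  set (e := Rmin 1 (eps / (2 * K))%R).
  assert (He' : (0 < e)%R).
  { apply Rmin_glb_lt; [lra|]. apply Rdiv_lt_0_compat; lra. }
  assert (HeK : (e * (2 * K) <= eps)%R).
  { replace eps with (eps / (2 * K) * (2 * K))%R by (field; lra).
    apply Rmult_le_compat_r; [lra|apply Rmin_r]. }
  assert (He1 : (e <= 1)%R) by apply Rmin_l.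
  generalize (filter_and _ _ (Hf e He') (Hg e He')).
  apply filter_imp. intros x [H1 H2].
  replace (f x * g x - l * m) with
    ((f x - l) * (g x - m) + ((f x - l) * m + l * (g x - m))) by ring.
  eapply Rle_lt_trans; [apply Cmod_triangle|].
  eapply Rle_lt_trans; [apply Rplus_le_compat_l, Cmod_triangle|].
  rewrite !Cmod_mult.
  pose proof (Cmod_ge_0 (f x - l)). pose proof (Cmod_ge_0 (g x - m)).
  assert (Cmod (f x - l) * Cmod (g x - m) <= e * 1)%R by (apply Rmult_le_compat; lra).
  assert (Cmod (f x - l) * Cmod m <= e * Cmod m)%R by (apply Rmult_le_compat_r; lra).
  assert (Cmod l * Cmod (g x - m) <= Cmod l * e)%R by (apply Rmult_le_compat_l; lra).
  assert (e * K < e * (2 * K))%R by nra.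
  unfold K in *. lra.
Qed.

Lemma ctends_opp (f : T -> C) (l : C) :
  ctends F f l -> ctends F (fun x => - f x) (- l).
Proof.
  intros Hf eps He. generalize (Hf eps He). apply filter_imp. intros x H.
  replace (- f x - - l) with (- (f x - l)) by ring. now rewrite Cmod_opp.
Qed.

Lemma ctends_minus (f g : T -> C) (l m : C) :
  ctends F f l -> ctends F g m -> ctends F (fun x => f x - g x) (l - m).
Proof. intros Hf Hg. apply ctends_plus; [auto|now apply ctends_opp]. Qed.

Lemma ctends_pow (f : T -> C) (l : C) (n : nat) :
  ctends F f l -> ctends F (fun x => f x ^ n) (l ^ n).
Proof.
  intros Hf. induction n as [|n IH].
  - exact (ctends_const 1).
  - simpl. now apply ctends_mult.
Qed.

Lemma ctends_inv (f : T -> C) (l : C) :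
  l <> 0 -> ctends F f l -> ctends F (fun x => / f x) (/ l).
Proof.
  intros Hl Hf eps He.
  assert (Hm : (0 < Cmod l)%R) by now apply Cmod_gt_0.
  set (m := Cmod l) in *.
  assert (Hmm : (0 < eps * (m * m / 2))%R) by (apply Rmult_lt_0_compat; nra).
  set (e := Rmin (m / 2) (eps * (m * m / 2))%R).
  assert (He' : (0 < e)%R) by (apply Rmin_glb_lt; lra).
  assert (E1 : (e <= m / 2)%R) by apply Rmin_l.
  assert (E2 : (e <= eps * (m * m / 2))%R) by apply Rmin_r.
  generalize (Hf e He'). apply filter_imp. intros x H.
  assert (Hfx : (m / 2 < Cmod (f x))%R).
  { pose proof (Cmod_triangle_rev l (f x)). rewrite Cmod_minus_sym in H0. fold m in H0. lra. }
  assert (f x <> 0) by (apply Cmod_gt_0; lra).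
  replace (/ f x - / l) with ((l - f x) * / (f x * l)) by (field; auto).
  rewrite Cmod_mult, Cmod_inv, Cmod_mult, Cmod_minus_sym by (now apply Cmult_neq_0).
  fold m.
  assert (HP : (0 < Cmod (f x) * m)%R) by nra.
  apply (Rmult_lt_reg_r (Cmod (f x) * m)); [auto|].
  replace (Cmod (f x - l) * / (Cmod (f x) * m) * (Cmod (f x) * m))%R
    with (Cmod (f x - l))%R by (field; split; lra).
  nra.
Qed.

Lemma ctends_div (f g : T -> C) (l m : C) :
  m <> 0 -> ctends F f l -> ctends F g m -> ctends F (fun x => f x / g x) (l / m).
Proof. intros Hm Hf Hg. apply ctends_mult; [auto|now apply ctends_inv]. Qed.

Lemma ctends_comp (f : T -> C) (h : C -> C) (z l : C) :
  ctends F f z -> ctends (cnbhs z) h l -> ctends F (fun x => h (f x)) l.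
Proof.
  intros Hf Hh eps He. destruct (Hh eps He) as [d [Hd H]].
  generalize (Hf d Hd). apply filter_imp. auto.
Qed.

Lemma ctends_le (f : T -> C) (l : C) (B : R) {PF : ProperFilter F} :
  ctends F f l -> F (fun x => Cmod (f x) <= B)%R -> (Cmod l <= B)%R.
Proof.
  intros Hf HB. apply Rnot_lt_le. intros Hlt.
  assert (He : (0 < Cmod l - B)%R) by lra.
  destruct (filter_ex _ (filter_and _ _ HB (Hf _ He))) as [x [H1 H2]].
  pose proof (Cmod_triangle_rev l (f x)). rewrite Cmod_minus_sym in H. lra.
Qed.

End Tends.

Lemma ctends_unique {T : Type} {F : (T -> Prop) -> Prop} {FF : ProperFilter F}
  (f : T -> C) (l m : C) : ctends F f l -> ctends F f m -> l = m.
Proof.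
  intros Hl Hm.
  assert (H : ctends F (fun _ => 0) (l - m)).
  { apply (ctends_ext (fun x => f x - f x)); [apply filter_forall; intros; ring|].
    now apply ctends_minus. }
  apply Ceq_minus, Cmod_eq_0, Rle_antisym; [|apply Cmod_ge_0].
  apply (ctends_le _ _ _ H). apply filter_forall. intros _. rewrite Cmod_0. lra.
Qed.

Lemma ctends_id (z : C) : ctends (cnbhs z) (fun y => y) z.
Proof. intros eps He. now exists eps. Qed.

Definition has_rderiv (g : R -> C) (t : R) (l : C) : Prop :=
  @is_derive R_AbsRing C_R_NormedModule g t l.

Definition rcont (g : R -> C) (t : R) : Prop := ctends (locally t) g (g t).

Lemma rcont_continuous (g : R -> C) (t : R) :
  rcont g t -> @continuous R_UniformSpace C_R_NormedModule g t.
Proof.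
  intros H. apply filterlim_locally. intros eps.
  generalize (H eps (cond_pos eps)). apply filter_imp. intros s Hs.
  now apply C_NormedModule_mixin_compat1.
Qed.

Lemma has_cderiv_iff (h : C -> C) (z l : C) :
  has_cderiv h z l <->
  (forall eps : R, (0 < eps)%R ->
   cnbhs z (fun y => (Cmod (h y - h z - (y - z) * l) <= eps * Cmod (y - z))%R)).
Proof.
  split.
  - intros [_ H] eps He.
    destruct (H z (fun P HP => HP) (mkposreal eps He)) as [d Hd].
    exists d. split; [apply cond_pos|]. intros y Hy. exact (Hd y Hy).
  - intros H. split; [apply is_linear_scal_l|].
    intros x Hx.
    rewrite <- (is_filter_lim_locally_unique _ _ Hx). intros eps.
    destruct (H eps (cond_pos eps)) as [d [Hd Hd']].
    exists (mkposreal d Hd). intros y Hy. exact (Hd' y Hy).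
Qed.

Lemma has_rderiv_iff (g : R -> C) (t : R) (l : C) :
  has_rderiv g t l <->
  (forall eps : R, (0 < eps)%R ->
   locally t (fun s => (Cmod (g s - g t - RtoC (s - t) * l) <= eps * Rabs (s - t))%R)).
Proof.
  assert (E : forall s, (@norm _ C_R_NormedModule (minus (minus (g s) (g t))
     (@scal _ C_R_NormedModule (minus s t) l)))
    = Cmod (g s - g t - RtoC (s - t) * l)).
  { intros s. rewrite scal_R_Cmult. symmetry. apply Cmod_norm. }
  split.
  - intros [_ H] eps He.
    generalize (H t (fun P HP => HP) (mkposreal eps He)). apply filter_imp.
    intros s Hs. rewrite <- E. exact Hs.
  - intros H. split; [apply is_linear_scal_l|].
    intros x Hx.
    rewrite <- (is_filter_lim_locally_unique _ _ Hx). intros eps.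
    generalize (H eps (cond_pos eps)). apply filter_imp.
    intros s Hs. rewrite <- E in Hs. exact Hs.
Qed.

(** Carathéodory's form of the derivative: the rules of differentiation become algebra of limits,
    and a zero of [h] at [z] factors out as [y - z]. *)
Lemma has_cderiv_slope (h : C -> C) (z l : C) :
  has_cderiv h z l <->
  exists phi : C -> C, phi z = l /\ ctends (cnbhs z) phi l /\
    forall y, h y = h z + (y - z) * phi y.
Proof.
  rewrite has_cderiv_iff. split.
  - intros H.
    exists (fun y => if Ceq_dec y z then l else (h y - h z) / (y - z)).
    split; [|split].
    + destruct (Ceq_dec z z) as [_|E]; [auto|now elim E].
    + intros eps He. generalize (H (eps / 2)%R ltac:(lra)). apply filter_imp. intros y Hy.
      destruct (Ceq_dec y z) as [->|E].
      * rewrite Cmod_minus_self. lra.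
      * apply Cminus_eq_contra in E.
        assert (Hp : (0 < Cmod (y - z))%R) by now apply Cmod_gt_0.
        replace ((h y - h z) / (y - z) - l) with ((h y - h z - (y - z) * l) / (y - z))
          by (field; auto).
        rewrite Cmod_div by auto.
        apply (Rmult_lt_reg_r (Cmod (y - z))); [auto|].
        unfold Rdiv. rewrite Rmult_assoc, Rinv_l by lra. nra.
    + intros y. destruct (Ceq_dec y z) as [->|E]; [ring|].
      apply Cminus_eq_contra in E. field. auto.
  - intros [phi [_ [Hphi Hh]]] eps He. generalize (Hphi eps He). apply filter_imp.
    intros y Hy. rewrite (Hh y).
    replace (h z + (y - z) * phi y - h z - (y - z) * l) with ((phi y - l) * (y - z)) by ring.
    rewrite Cmod_mult. apply Rmult_le_compat_r; [apply Cmod_ge_0|lra].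
Qed.

Lemma has_rderiv_slope (g : R -> C) (t : R) (phi : R -> C) :
  ctends (locally t) phi (phi t) ->
  (forall s, g s = g t + RtoC (s - t) * phi s) -> has_rderiv g t (phi t).
Proof.
  intros Hphi Hg. apply has_rderiv_iff. intros eps He.
  generalize (Hphi eps He). apply filter_imp. intros s Hs. rewrite (Hg s).
  replace (g t + RtoC (s - t) * phi s - g t - RtoC (s - t) * phi t)
    with ((phi s - phi t) * RtoC (s - t)) by ring.
  rewrite Cmod_mult, Cmod_R. apply Rmult_le_compat_r; [apply Rabs_pos|lra].
Qed.

Lemma has_cderiv_ctends (h : C -> C) (z l : C) :
  has_cderiv h z l -> ctends (cnbhs z) h (h z).
Proof.
  intros H. apply has_cderiv_slope in H. destruct H as [phi [_ [Hphi Hh]]].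
  apply (ctends_ext (fun y => h z + (y - z) * phi y)).
  { apply filter_forall. intros y. now rewrite (Hh y). }
  assert (E : ctends (cnbhs z) (fun y => h z + (y - z) * phi y) (h z + (z - z) * l)).
  { apply ctends_plus; [apply ctends_const|]. apply ctends_mult; [|auto].
    apply ctends_minus; [apply ctends_id|apply ctends_const]. }
  replace (h z + (z - z) * l) with (h z) in E by ring. exact E.
Qed.

Lemma has_rderiv_ctends (g : R -> C) (t : R) (l : C) : has_rderiv g t l -> rcont g t.
Proof.
  intros H eps He. apply has_rderiv_iff with (eps := 1%R) in H; [|lra].
  set (K := (Cmod l + 1)%R).
  assert (HK : (0 < K)%R) by (unfold K; pose proof (Cmod_ge_0 l); lra).
  assert (HeK : (0 < eps / K)%R) by (apply Rdiv_lt_0_compat; lra).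
  generalize (filter_and _ _ H (locally_ball t (mkposreal _ HeK))). apply filter_imp.
  intros s [H1 H2]. change (Rabs (s - t) < eps / K)%R in H2.
  assert (H3 : (Rabs (s - t) * K < eps)%R).
  { apply (Rmult_lt_compat_r K) in H2; [|auto].
    replace (eps / K * K)%R with eps in H2 by (field; lra). auto. }
  replace (g s - g t) with ((g s - g t - RtoC (s - t) * l) + RtoC (s - t) * l) by ring.
  eapply Rle_lt_trans; [apply Cmod_triangle|]. rewrite Cmod_mult, Cmod_R.
  unfold K in H3. lra.
Qed.

Lemma has_cderiv_ext_loc (h k : C -> C) (z l : C) :
  cnbhs z (fun y => h y = k y) -> has_cderiv h z l -> has_cderiv k z l.
Proof.
  rewrite !has_cderiv_iff. intros E H eps He.
  assert (Ez : h z = k z).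
  { destruct E as [d [Hd E]]. apply E. now rewrite Cmod_minus_self. }
  generalize (filter_and _ _ E (H eps He)). apply filter_imp.
  intros y [<- ?]. now rewrite <- Ez.
Qed.

Lemma has_cderiv_unique (h : C -> C) (z l m : C) :
  has_cderiv h z l -> has_cderiv h z m -> l = m.
Proof.
  intros Hl Hm. rewrite <- (is_C_derive_unique h z l Hl). now apply is_C_derive_unique.
Qed.

Lemma has_cderiv_const (c z : C) : has_cderiv (fun _ => c) z 0.
Proof.
  apply has_cderiv_slope. exists (fun _ => 0). repeat split; [apply ctends_const|].
  intros; ring.
Qed.

Lemma has_cderiv_id (z : C) : has_cderiv (fun y => y) z 1.
Proof.
  apply has_cderiv_slope. exists (fun _ => 1). repeat split; [apply ctends_const|].
  intros; ring.
Qed.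

Lemma has_cderiv_plus (h k : C -> C) (z l m : C) :
  has_cderiv h z l -> has_cderiv k z m -> has_cderiv (fun y => h y + k y) z (l + m).
Proof.
  rewrite !has_cderiv_slope.
  intros [phi [E1 [H1 H2]]] [psi [E2 [K1 K2]]].
  exists (fun y => phi y + psi y). rewrite E1, E2. repeat split.
  - now apply ctends_plus.
  - intros y. rewrite (H2 y), (K2 y). ring.
Qed.

Lemma has_cderiv_mult (h k : C -> C) (z l m : C) :
  has_cderiv h z l -> has_cderiv k z m ->
  has_cderiv (fun y => h y * k y) z (l * k z + h z * m).
Proof.
  intros Hh Hk. pose proof (has_cderiv_ctends _ _ _ Hk) as Ck.
  revert Hh Hk. rewrite !has_cderiv_slope.
  intros [phi [E1 [H1 H2]]] [psi [E2 [K1 K2]]].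
  exists (fun y => phi y * k y + h z * psi y). rewrite E1, E2. repeat split.
  - apply ctends_plus; apply ctends_mult; auto. apply ctends_const.
  - intros y. rewrite (H2 y), (K2 y). ring.
Qed.

Lemma has_cderiv_scal (c : C) (h : C -> C) (z l : C) :
  has_cderiv h z l -> has_cderiv (fun y => c * h y) z (c * l).
Proof.
  intros H. pose proof (has_cderiv_mult _ _ _ _ _ (has_cderiv_const c z) H) as E.
  replace (c * l) with (0 * h z + c * l) by ring. exact E.
Qed.

Lemma has_cderiv_minus (h k : C -> C) (z l m : C) :
  has_cderiv h z l -> has_cderiv k z m -> has_cderiv (fun y => h y - k y) z (l - m).
Proof.
  intros Hh Hk. replace (l - m) with (l + (- (1)) * m) by ring.
  apply (has_cderiv_ext_loc (fun y => h y + (- (1)) * k y)).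
  - apply filter_forall. intros y. ring.
  - apply has_cderiv_plus; [auto|now apply has_cderiv_scal].
Qed.

Lemma has_cderiv_inv (h : C -> C) (z l : C) :
  h z <> 0 -> has_cderiv h z l -> has_cderiv (fun y => / h y) z (- l / (h z * h z)).
Proof.
  intros Hz Hh. pose proof (has_cderiv_ctends _ _ _ Hh) as Ch.
  assert (Nz : cnbhs z (fun y => h y <> 0)).
  { generalize (Ch (Cmod (h z)) (proj1 (Cmod_gt_0 _) Hz)). apply filter_imp.
    intros y Hy E. rewrite E, Cmod_minus_sym in Hy.
    replace (h z - 0) with (h z) in Hy by ring. lra. }
  apply has_cderiv_slope in Hh. destruct Hh as [phi [E1 [H1 H2]]].
  assert (T : ctends (cnbhs z) (fun y => - phi y / (h y * h z)) (- l / (h z * h z))).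
  { apply ctends_div; [now apply Cmult_neq_0|now apply ctends_opp|].
    apply ctends_mult; [auto|apply ctends_const]. }
  apply has_cderiv_iff. intros eps He.
  generalize (filter_and _ _ Nz (T eps He)). apply filter_imp. intros y [Hy Ty].
  assert (E : / h y - / h z = (y - z) * (- phi y / (h y * h z))).
  { replace (/ h y - / h z) with (- (h y - h z) / (h y * h z)) by (field; auto).
    rewrite (H2 y) at 1. field. auto. }
  rewrite E.
  replace ((y - z) * (- phi y / (h y * h z)) - (y - z) * (- l / (h z * h z)))
    with ((- phi y / (h y * h z) - - l / (h z * h z)) * (y - z)) by ring.
  rewrite Cmod_mult. apply Rmult_le_compat_r; [apply Cmod_ge_0|lra].
Qed.

Lemma has_cderiv_pow (h : C -> C) (z l : C) (n : nat) :
  has_cderiv h z l -> exists m, has_cderiv (fun y => h y ^ n) z m.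
Proof.
  intros H. induction n as [|n [m IH]].
  - exists 0. exact (has_cderiv_const 1 z).
  - eexists. exact (has_cderiv_mult _ _ _ _ _ H IH).
Qed.

(** The error splits into a product of two errors and one term linear in each, together at most
    [e * K * Rabs (s - t)]; this explains [K] and [e]. *)
Lemma has_rderiv_comp (h : C -> C) (g : R -> C) (t : R) (l m : C) :
  has_cderiv h (g t) l -> has_rderiv g t m -> has_rderiv (fun s => h (g s)) t (l * m).
Proof.
  intros Hh Hg. pose proof (has_rderiv_ctends _ _ _ Hg) as Cg.
  apply has_cderiv_slope in Hh. destruct Hh as [phi [E [H1 H2]]].
  assert (T : ctends (locally t) (fun s => phi (g s)) l).
  { now apply (ctends_comp g phi (g t)). }
  pose proof Hg as Hg'. rewrite has_rderiv_iff in Hg. apply has_rderiv_iff.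
  intros eps He.
  set (K := (Cmod l + Cmod m + 1)%R).
  pose proof (Cmod_ge_0 l). pose proof (Cmod_ge_0 m).
  assert (HK : (0 < K)%R) by (unfold K; lra).
  set (e := Rmin 1 (eps / (2 * K))%R).
  assert (He' : (0 < e)%R).
  { apply Rmin_glb_lt; [lra|]. apply Rdiv_lt_0_compat; lra. }
  assert (HeK : (e * (2 * K) <= eps)%R).
  { replace eps with (eps / (2 * K) * (2 * K))%R by (field; lra).
    apply Rmult_le_compat_r; [lra|apply Rmin_r]. }
  assert (He1 : (e <= 1)%R) by apply Rmin_l.
  generalize (filter_and _ _ (T e He') (Hg e He')). apply filter_imp. intros s [Ts Gs].
  rewrite (H2 (g s)).
  replace (h (g t) + (g s - g t) * phi (g s) - h (g t) - RtoC (s - t) * (l * m)) with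
    ((g s - g t - RtoC (s - t) * m) * (phi (g s) - l)
     + ((g s - g t - RtoC (s - t) * m) * l + RtoC (s - t) * m * (phi (g s) - l))) by ring.
  eapply Rle_trans; [apply Cmod_triangle|].
  eapply Rle_trans; [apply Rplus_le_compat_l, Cmod_triangle|].
  rewrite !Cmod_mult, Cmod_R.
  set (u := Cmod (g s - g t - RtoC (s - t) * m)) in *.
  set (v := Cmod (phi (g s) - l)) in *. set (w := Rabs (s - t)) in *.
  assert (Hu : (0 <= u)%R) by apply Cmod_ge_0.
  assert (Hv : (0 <= v)%R) by apply Cmod_ge_0.
  assert (Hw : (0 <= w)%R) by apply Rabs_pos.
  assert (u * v <= e * w * 1)%R by (apply Rmult_le_compat; lra).
  assert (u * Cmod l <= e * w * Cmod l)%R by (apply Rmult_le_compat_r; lra).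
  assert (w * Cmod m * v <= w * Cmod m * e)%R by (apply Rmult_le_compat_l; nra).
  assert (e * (2 * K) * w <= eps * w)%R by (apply Rmult_le_compat_r; lra).
  assert (0 <= e * K * w)%R.
  { apply Rmult_le_pos; [apply Rmult_le_pos|]; lra. }
  assert (e * w * 1 + (e * w * Cmod l + w * Cmod m * e) = e * K * w)%R
    by (unfold K; ring).
  lra.
Qed.

Lemma has_rderiv_RtoC (t : R) : has_rderiv RtoC t 1.
Proof.
  apply (has_rderiv_slope RtoC t (fun _ => 1)); [apply ctends_const|].
  intros s. rewrite RtoC_minus. ring.
Qed.

Lemma has_rderiv_pair (u v : R -> R) (t u' v' : R) :
  is_derive u t u' -> is_derive v t v' -> has_rderiv (fun s => (u s, v s)) t (u', v').
Proof.
  intros [_ Hu] [_ Hv]. apply has_rderiv_iff. intros eps He.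
  assert (He2 : (0 < eps / 2)%R) by lra.
  generalize (filter_and _ _ (Hu t (fun P HP => HP) (mkposreal _ He2))
     (Hv t (fun P HP => HP) (mkposreal _ He2))).
  apply filter_imp. intros s [H1 H2].
  change (Rabs (u s - u t - (s - t) * u') <= eps / 2 * Rabs (s - t))%R in H1.
  change (Rabs (v s - v t - (s - t) * v') <= eps / 2 * Rabs (s - t))%R in H2.
  replace ((u s, v s) - (u t, v t) - RtoC (s - t) * (u', v')) with
    (RtoC (u s - u t - (s - t) * u') + Ci * RtoC (v s - v t - (s - t) * v')).
  2:{ unfold RtoC, Ci, Cminus, Cplus, Cmult, Copp; simpl. f_equal; ring. }
  eapply Rle_trans; [apply Cmod_triangle|].
  rewrite Cmod_mult, Cmod_Ci, !Cmod_R. lra.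
Qed.

Definition expi (s : R) : C := (cos s, sin s).

Lemma has_rderiv_expi (s : R) : has_rderiv expi s (Ci * expi s).
Proof.
  replace (Ci * expi s) with ((- sin s)%R, cos s).
  - apply has_rderiv_pair; [apply is_derive_cos|apply is_derive_sin].
  - unfold Ci, expi, Cmult; simpl. f_equal; ring.
Qed.

Lemma Cmod_expi (s : R) : Cmod (expi s) = 1%R.
Proof.
  unfold Cmod, expi. transitivity (sqrt 1); [|apply sqrt_1]. f_equal. simpl.
  pose proof (sin2_cos2 s) as H. unfold Rsqr in H. lra.
Qed.

(** * Integrals of complex functions of a real variable *)

Definition CI (f : R -> C) (a b : R) : C := @RInt C_R_CompleteNormedModule f a b.

Definition cont_on (f : R -> C) (a b : R) : Prop :=
  forall x, (a <= x <= b)%R -> rcont f x.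

Lemma CI_unique (f : R -> C) (a b : R) (l : C) :
  @is_RInt C_R_NormedModule f a b l -> CI f a b = l.
Proof. apply (@is_RInt_unique C_R_CompleteNormedModule). Qed.

Lemma ex_CI (f : R -> C) (a b : R) : (a <= b)%R -> cont_on f a b ->
  @ex_RInt C_R_CompleteNormedModule f a b.
Proof.
  intros Hab Hf. apply (@ex_RInt_continuous C_R_CompleteNormedModule).
  rewrite Rmin_left, Rmax_right by auto. intros x Hx. apply rcont_continuous. auto.
Qed.

Lemma is_CI (f : R -> C) (a b : R) : (a <= b)%R -> cont_on f a b ->
  @is_RInt C_R_NormedModule f a b (CI f a b).
Proof.
  intros Hab Hf. apply (@RInt_correct C_R_CompleteNormedModule). now apply ex_CI.
Qed.

Lemma CI_ext (f g : R -> C) (a b : R) : (a <= b)%R ->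
  (forall x, (a <= x <= b)%R -> f x = g x) -> CI f a b = CI g a b.
Proof.
  intros Hab H. apply (@RInt_ext C_R_CompleteNormedModule).
  rewrite Rmin_left, Rmax_right by auto. intros x Hx. apply H. lra.
Qed.

Lemma CI_plus (f g : R -> C) (a b : R) : (a <= b)%R -> cont_on f a b -> cont_on g a b ->
  CI (fun x => f x + g x) a b = CI f a b + CI g a b.
Proof.
  intros Hab Hf Hg. apply CI_unique. apply (@is_RInt_plus C_R_NormedModule); now apply is_CI.
Qed.

Lemma CI_minus (f g : R -> C) (a b : R) : (a <= b)%R -> cont_on f a b -> cont_on g a b ->
  CI (fun x => f x - g x) a b = CI f a b - CI g a b.
Proof.
  intros Hab Hf Hg. apply CI_unique. apply (@is_RInt_minus C_R_NormedModule); now apply is_CI.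
Qed.

(** The integral lives in [C] as a real space, where only real scalars come out directly; a complex
    one is treated through real and imaginary parts. *)
Lemma CI_scal (k : C) (f : R -> C) (a b : R) : (a <= b)%R -> cont_on f a b ->
  CI (fun x => k * f x) a b = k * CI f a b.
Proof.
  intros Hab Hf. apply CI_unique.
  pose proof (is_CI f a b Hab Hf) as H. destruct k as [u v].
  pose proof (is_RInt_fct_extend_fst (U := R_NormedModule) (V := R_NormedModule) _ _ _ _ H) as H1.
  pose proof (is_RInt_fct_extend_snd (U := R_NormedModule) (V := R_NormedModule) _ _ _ _ H) as H2.
  apply (is_RInt_fct_extend_pair (U := R_NormedModule) (V := R_NormedModule)); simpl.
  - exact (is_RInt_minus (V := R_NormedModule) _ _ _ _ _ _
      (is_RInt_scal (V := R_NormedModule) _ _ _ u _ H1)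
      (is_RInt_scal (V := R_NormedModule) _ _ _ v _ H2)).
  - exact (is_RInt_plus (V := R_NormedModule) _ _ _ _ _ _
      (is_RInt_scal (V := R_NormedModule) _ _ _ u _ H2)
      (is_RInt_scal (V := R_NormedModule) _ _ _ v _ H1)).
Qed.

Lemma CI_Chasles (f : R -> C) (a b c : R) : (a <= b)%R -> (b <= c)%R -> cont_on f a c ->
  CI f a c = CI f a b + CI f b c.
Proof.
  intros Hab Hbc Hf. symmetry. apply (@RInt_Chasles C_R_CompleteNormedModule);
  apply ex_CI; auto; intros x Hx; apply Hf; lra.
Qed.

Lemma Cmod_CI_le (f : R -> C) (a b M : R) : (a <= b)%R -> cont_on f a b ->
  (forall x, (a <= x <= b)%R -> (Cmod (f x) <= M)%R) -> (Cmod (CI f a b) <= (b - a) * M)%R.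
Proof.
  intros Hab Hf HM. rewrite Cmod_norm.
  apply (norm_RInt_le_const (V := C_R_NormedModule) f a b); auto.
  - intros x Hx. specialize (HM x Hx). rewrite Cmod_norm in HM. exact HM.
  - now apply is_CI.
Qed.

Lemma CI_deriv (f df : R -> C) (a b : R) : (a <= b)%R ->
  (forall x, (a <= x <= b)%R -> has_rderiv f x (df x)) -> cont_on df a b ->
  CI df a b = f b - f a.
Proof.
  intros Hab Hf Hdf. apply CI_unique.
  apply (@is_RInt_derive C_R_CompleteNormedModule);
    rewrite Rmin_left, Rmax_right by auto; intros x Hx.
  - apply Hf; auto.
  - apply rcont_continuous. auto.
Qed.

Lemma rcont_mult (f g : R -> C) (x : R) : rcont f x -> rcont g x -> rcont (fun y => f y * g y) x.
Proof. apply ctends_mult. Qed.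

Lemma rcont_comp (q : C -> C) (f : R -> C) (x : R) (l : C) :
  has_cderiv q (f x) l -> rcont f x -> rcont (fun y => q (f y)) x.
Proof.
  intros Hq Hf. apply (ctends_comp f q (f x)); [auto|]. exact (has_cderiv_ctends _ _ _ Hq).
Qed.

(** * Goursat's theorem for the image of a rectangle *)

(** Obtained by integrating [dg], since the mean value theorem fails for complex values. *)
Lemma path_lipschitz (g dg : R -> C) (L x y : R) :
  (forall t, has_rderiv g t (dg t)) -> (forall t, rcont dg t) ->
  (forall t, (Rmin x y <= t <= Rmax x y)%R -> (Cmod (dg t) <= L)%R) ->
  (Cmod (g x - g y) <= L * Rabs (x - y))%R.
Proof.
  intros Hg Hc HL.
  assert (K : forall u v, (u <= v)%R ->
    (forall t, (u <= t <= v)%R -> (Cmod (dg t) <= L)%R) -> (Cmod (g v - g u) <= L * (v - u))%R).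
  { intros u v Huv HB. rewrite <- (CI_deriv g dg u v); auto; [|intros z _; apply Hc].
    rewrite Rmult_comm. apply Cmod_CI_le; auto. intros z _; apply Hc. }
  destruct (Rle_dec x y) as [H|H].
  - rewrite Rmin_left, Rmax_right in HL by auto.
    rewrite Cmod_minus_sym, Rabs_minus_sym, Rabs_pos_eq by lra. auto.
  - rewrite Rmin_right, Rmax_left in HL by lra.
    rewrite Rabs_pos_eq by lra. apply K; [lra|auto].
Qed.

Definition affine_prim (A B w z : C) : C := A * z + B * ((z - w) * (z - w)) / 2.

Lemma has_cderiv_affine_prim (A B w z : C) :
  has_cderiv (affine_prim A B w) z (A + B * (z - w)).
Proof.
  apply has_cderiv_slope. exists (fun y => A + B * (y - w + (z - w)) / 2).
  assert (E : A + B * (z - w + (z - w)) / 2 = A + B * (z - w)) by field.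
  repeat split; auto.
  - rewrite <- E. apply ctends_plus; [apply ctends_const|].
    apply ctends_mult; [|apply ctends_const]. apply ctends_mult; [apply ctends_const|].
    apply ctends_plus; [|apply ctends_const].
    apply ctends_minus; [apply ctends_id|apply ctends_const].
  - intros y. unfold affine_prim. field.
Qed.

(** The affine part of [q] has the primitive [affine_prim], so its integral along an edge depends
    only on the endpoints; what remains is the integral of the deviation of [q] from that part. *)
Lemma edge_approx (q : C -> C) (g dg : R -> C) (A B w : C) (x y M : R) :
  (x <= y)%R -> (forall t, has_rderiv g t (dg t)) -> (forall t, rcont dg t) ->
  (forall t, (x <= t <= y)%R -> exists l, has_cderiv q (g t) l) ->
  (forall t, (x <= t <= y)%R -> (Cmod ((q (g t) - (A + B * (g t - w))) * dg t) <= M)%R) ->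
  (Cmod (CI (fun t => q (g t) * dg t)%C x y
     - (affine_prim A B w (g y) - affine_prim A B w (g x))) <= (y - x) * M)%R.
Proof.
  intros Hxy Hg Hc Hq HM.
  assert (Cg : forall t, rcont g t) by (intros t; exact (has_rderiv_ctends _ _ _ (Hg t))).
  assert (C1 : cont_on (fun t => (A + B * (g t - w)) * dg t) x y).
  { intros t _. apply rcont_mult; [|apply Hc].
    apply ctends_plus; [apply ctends_const|]. apply ctends_mult; [apply ctends_const|].
    apply ctends_minus; [apply Cg|apply ctends_const]. }
  assert (C2 : cont_on (fun t => q (g t) * dg t) x y).
  { intros t Ht. apply rcont_mult; [|apply Hc]. destruct (Hq t Ht) as [l Hl].
    exact (rcont_comp _ _ _ _ Hl (Cg t)). }
  rewrite <- (CI_deriv (fun t => affine_prim A B w (g t))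
     (fun t => (A + B * (g t - w)) * dg t) x y); auto.
  2:{ intros t _. apply (has_rderiv_comp (affine_prim A B w)); [|auto].
      apply has_cderiv_affine_prim. }
  rewrite <- CI_minus by auto. apply Cmod_CI_le; auto.
  - intros t Ht. apply ctends_minus; [now apply C2|now apply C1].
  - intros t Ht. specialize (HM t Ht).
    replace (q (g t) * dg t - (A + B * (g t - w)) * dg t)
      with ((q (g t) - (A + B * (g t - w))) * dg t) by ring. auto.
Qed.

Section Goursat.

Variables (q : C -> C) (G Gt Gs : R -> R -> C) (a b c d L : R).
Hypothesis Hab : (a <= b)%R.
Hypothesis Hcd : (c <= d)%R.
Hypothesis DGt : forall t s, has_rderiv (fun t => G t s) t (Gt t s).
Hypothesis DGs : forall t s, has_rderiv (fun s => G t s) s (Gs t s).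
Hypothesis CGt : forall t s, rcont (fun t => Gt t s) t.
Hypothesis CGs : forall t s, rcont (fun s => Gs t s) s.
Hypothesis BGt : forall t s, (a <= t <= b)%R -> (c <= s <= d)%R -> (Cmod (Gt t s) <= L)%R.
Hypothesis BGs : forall t s, (a <= t <= b)%R -> (c <= s <= d)%R -> (Cmod (Gs t s) <= L)%R.
Hypothesis Dq : forall t s, (a <= t <= b)%R -> (c <= s <= d)%R ->
  exists l, has_cderiv q (G t s) l.

Let Et (t1 t2 s : R) : C := CI (fun t => q (G t s) * Gt t s) t1 t2.
Let Es (t s1 s2 : R) : C := CI (fun s => q (G t s) * Gs t s) s1 s2.
(** The contour integral of [q] along the image of the boundary, traversed bottom, right, top, left;
    shared edges cancel, which gives additivity. *)
Let Phi (t1 t2 s1 s2 : R) : C := Et t1 t2 s1 + Es t2 s1 s2 - Et t1 t2 s2 - Es t1 s1 s2.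

Lemma edge_t_cont (t1 t2 s : R) : (a <= t1)%R -> (t2 <= b)%R -> (c <= s <= d)%R ->
  cont_on (fun t => q (G t s) * Gt t s) t1 t2.
Proof.
  intros H1 H2 H3 t Ht. apply rcont_mult; [|apply CGt].
  destruct (Dq t s) as [l Hl]; [lra|lra|].
  exact (rcont_comp q (fun t => G t s) t l Hl (has_rderiv_ctends _ _ _ (DGt t s))).
Qed.

Lemma edge_s_cont (t s1 s2 : R) : (a <= t <= b)%R -> (c <= s1)%R -> (s2 <= d)%R ->
  cont_on (fun s => q (G t s) * Gs t s) s1 s2.
Proof.
  intros H1 H2 H3 s Hs. apply rcont_mult; [|apply CGs].
  destruct (Dq t s) as [l Hl]; [lra|lra|].
  exact (rcont_comp q (fun s => G t s) s l Hl (has_rderiv_ctends _ _ _ (DGs t s))).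
Qed.

Lemma G_lipschitz (t s t' s' : R) : (a <= t <= b)%R -> (c <= s <= d)%R ->
  (a <= t' <= b)%R -> (c <= s' <= d)%R ->
  (Cmod (G t s - G t' s') <= L * (Rabs (t - t') + Rabs (s - s')))%R.
Proof.
  intros Ht Hs Ht' Hs'.
  replace (G t s - G t' s') with ((G t s - G t' s) + (G t' s - G t' s')) by ring.
  eapply Rle_trans; [apply Cmod_triangle|]. rewrite Rmult_plus_distr_l.
  apply Rplus_le_compat.
  - apply (path_lipschitz (fun t => G t s) (fun t => Gt t s)); auto.
    intros u Hu. apply BGt; auto. unfold Rmin, Rmax in Hu. destruct Rle_dec; lra.
  - apply (path_lipschitz (fun s => G t' s) (fun s => Gs t' s)); auto.
    intros u Hu. apply BGs; auto. unfold Rmin, Rmax in Hu. destruct Rle_dec; lra.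
Qed.

Lemma Phi_local (x y : R) : (a <= x <= b)%R -> (c <= y <= d)%R ->
  forall eps, (0 < eps)%R -> exists del, (0 < del)%R /\
  forall t1 t2 s1 s2,
  (a <= t1 <= x)%R -> (x <= t2 <= b)%R -> (c <= s1 <= y)%R -> (y <= s2 <= d)%R ->
  (t2 - t1 < del)%R -> (s2 - s1 < del)%R ->
  (Cmod (Phi t1 t2 s1 s2) <= eps * ((t2 - t1) + (s2 - s1)) ^ 2)%R.
Proof.
  intros Hx Hy eps He.
  assert (HL : (0 <= L)%R).
  { eapply Rle_trans; [apply Cmod_ge_0|]. exact (BGt x y Hx Hy). }
  destruct (Dq x y Hx Hy) as [l Hl].
  (* On a rectangle of half-perimeter [W] the deviation of [q] from its affine part is at most
     [e * L * W], the speed at most [L] and the parameter length of the boundary [2 * W], in total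
     [2 * e * L ^ 2 * W ^ 2]. *)
  set (e := (eps / (2 * L * L + 1))%R).
  assert (HLL : (0 <= 2 * L * L)%R) by nra.
  assert (He' : (0 < e)%R) by (apply Rdiv_lt_0_compat; lra).
  assert (HeL : (e * (2 * L * L) <= eps)%R).
  { replace eps with (e * (2 * L * L + 1))%R by (unfold e; field; lra). nra. }
  destruct (proj1 (has_cderiv_iff _ _ _) Hl e He') as [dq [Hdq Hq]].
  (* Both sides below this value give [L * W < dq], so the whole image lies where the first-order
     expansion holds. *)
  exists (dq / (2 * (L + 1)))%R. split; [apply Rdiv_lt_0_compat; lra|].
  intros t1 t2 s1 s2 H1 H2 H3 H4 Dt Ds.
  set (W := ((t2 - t1) + (s2 - s1))%R).
  assert (HW : (0 <= W)%R) by (unfold W; lra).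
  assert (HLW : (L * W < dq)%R).
  { assert (W < dq / (L + 1))%R.
    { replace (dq / (L + 1))%R with (2 * (dq / (2 * (L + 1))))%R by (field; lra).
      unfold W; lra. }
    assert (W * (L + 1) < dq)%R.
    { apply (Rmult_lt_compat_r (L + 1)) in H; [|lra].
      replace (dq / (L + 1) * (L + 1))%R with dq in H by (field; lra). lra. }
    nra. }
  assert (Hnear : forall t s, (t1 <= t <= t2)%R -> (s1 <= s <= s2)%R ->
    (Cmod (q (G t s) - (q (G x y) + l * (G t s - G x y))) <= e * (L * W))%R).
  { intros t s Ht Hs.
    assert (Hd : (Cmod (G t s - G x y) <= L * W)%R).
    { eapply Rle_trans; [apply G_lipschitz; lra|]. apply Rmult_le_compat_l; [auto|].
      unfold W. apply Rplus_le_compat; apply Rabs_le; lra. }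
    replace (q (G t s) - (q (G x y) + l * (G t s - G x y)))
      with (q (G t s) - q (G x y) - (G t s - G x y) * l) by ring.
    eapply Rle_trans; [apply Hq; lra|]. apply Rmult_le_compat_l; lra. }
  set (M := (e * (L * W) * L)%R).
  assert (HLW0 : (0 <= L * W)%R) by (apply Rmult_le_pos; lra).
  assert (HM : forall u v : C, (Cmod u <= e * (L * W))%R -> (Cmod v <= L)%R ->
    (Cmod (u * v) <= M)%R).
  { intros u v Hu Hv. rewrite Cmod_mult. unfold M.
    apply Rmult_le_compat; auto; apply Cmod_ge_0. }
  set (P := affine_prim (q (G x y)) l (G x y)).
  assert (It : forall s, (s1 <= s <= s2)%R ->
    (Cmod (Et t1 t2 s - (P (G t2 s) - P (G t1 s))) <= (t2 - t1) * M)%R).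
  { intros s Hs. apply (edge_approx q (fun t => G t s) (fun t => Gt t s)); auto; [lra| |].
    - intros t Ht. apply Dq; lra.
    - intros t Ht. apply HM; [apply Hnear; lra|apply BGt; lra]. }
  assert (Is : forall t, (t1 <= t <= t2)%R ->
    (Cmod (Es t s1 s2 - (P (G t s2) - P (G t s1))) <= (s2 - s1) * M)%R).
  { intros t Ht. apply (edge_approx q (fun s => G t s) (fun s => Gs t s)); auto; [lra| |].
    - intros s Hs. apply Dq; lra.
    - intros s Hs. apply HM; [apply Hnear; lra|apply BGs; lra]. }
  assert (I1 := It s1 ltac:(lra)). assert (I2 := It s2 ltac:(lra)).
  assert (I3 := Is t1 ltac:(lra)). assert (I4 := Is t2 ltac:(lra)).
  (* The values of [P] at the four corners cancel around the closed contour. *)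
  replace (Phi t1 t2 s1 s2) with
    ((Et t1 t2 s1 - (P (G t2 s1) - P (G t1 s1)))
     + (Es t2 s1 s2 - (P (G t2 s2) - P (G t2 s1)))
     - (Et t1 t2 s2 - (P (G t2 s2) - P (G t1 s2)))
     - (Es t1 s1 s2 - (P (G t1 s2) - P (G t1 s1)))) by (unfold Phi; ring).
  eapply Rle_trans; [apply Cmod_minus_le|].
  eapply Rle_trans; [apply Rplus_le_compat_r, Cmod_minus_le|].
  eapply Rle_trans; [apply Rplus_le_compat_r, Rplus_le_compat_r, Cmod_triangle|].
  assert (Hfin : (2 * W * M <= eps * W ^ 2)%R).
  { replace (2 * W * M)%R with (e * (2 * L * L) * W ^ 2)%R by (unfold M; ring).
    apply Rmult_le_compat_r; [nra|auto]. }
  unfold W in Hfin |- *. lra.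
Qed.

(** Bisecting in the parameter plane rather than in the image permits images that close up on
    themselves, such as the annular regions of [circle_deform]. *)
Lemma goursat :
  CI (fun t => q (G t c) * Gt t c) a b + CI (fun s => q (G b s) * Gs b s) c d
  - CI (fun t => q (G t d) * Gt t d) a b - CI (fun s => q (G a s) * Gs a s) c d = 0.
Proof.
  change (Phi a b c d = 0). apply (additive_rectangle_zero Phi); auto.
  - intros t1 t t2 s1 s2 H1 H2 H3 H4. unfold Phi, Et.
    rewrite (CI_Chasles _ t1 t t2), (CI_Chasles (fun t => q (G t s2) * Gt t s2) t1 t t2);
      try lra; [ring| |]; apply edge_t_cont; lra.
  - intros t1 t2 s1 s s2 H1 H2 H3 H4. unfold Phi, Es.
    rewrite (CI_Chasles _ s1 s s2), (CI_Chasles (fun s => q (G t1 s) * Gs t1 s) s1 s s2);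
      try lra; [ring| |]; apply edge_s_cont; lra.
  - apply Phi_local.
Qed.

End Goursat.

(** * Cauchy's formula and Taylor's theorem *)

Lemma is_series_ctends (a : nat -> C) (l : C) :
  @is_series C_AbsRing C_NormedModule a l <-> ctends eventually (sum_n a) l.
Proof.
  split.
  - intros H eps He.
    assert (He' : (0 < eps / sqrt 2)%R).
    { apply Rdiv_lt_0_compat; [auto|]. apply sqrt_lt_R0. lra. }
    generalize (proj1 (filterlim_locally _ _) H (mkposreal _ He')). apply filter_imp.
    intros n Hn. apply (C_NormedModule_mixin_compat2 l _) in Hn. simpl in Hn.
    replace (sqrt 2 * (eps / sqrt 2))%R with eps in Hn; [exact Hn|].
    field. apply Rgt_not_eq, sqrt_lt_R0. lra.
  - intros H. apply filterlim_locally. intros eps.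
    generalize (H eps (cond_pos eps)). apply filter_imp. intros n Hn.
    now apply C_NormedModule_mixin_compat1.
Qed.

Lemma sum_n_O_C (a : nat -> C) : sum_n a O = a O.
Proof. apply sum_O. Qed.

Lemma sum_n_S_C (a : nat -> C) (n : nat) : sum_n a (S n) = sum_n a n + a (S n).
Proof. now rewrite sum_Sn. Qed.

Lemma expi_nz (s : R) : expi s <> 0.
Proof. apply Cmod_gt_0. rewrite Cmod_expi. lra. Qed.

Lemma RtoC_nz (r : R) : r <> 0%R -> RtoC r <> 0.
Proof. intros H E. apply H. now apply RtoC_inj. Qed.

Lemma expi_period : expi (2 * PI) = expi 0.
Proof. unfold expi. now rewrite cos_2PI, sin_2PI, cos_0, sin_0. Qed.

Lemma expi_plus (s t : R) : expi (s + t) = expi s * expi t.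
Proof.
  unfold expi, Cmult; simpl. rewrite cos_plus, sin_plus. f_equal; ring.
Qed.

Lemma rcont_expi (s : R) : rcont expi s.
Proof. exact (has_rderiv_ctends _ _ _ (has_rderiv_expi s)). Qed.

Lemma rcont_const (c : C) (s : R) : rcont (fun _ => c) s.
Proof. apply ctends_const. Qed.

Lemma has_rderiv_affine (g : R -> C) (A B l : C) (t : R) :
  has_rderiv g t l -> has_rderiv (fun s => A + B * g s) t (B * l).
Proof.
  intros H. apply (has_rderiv_comp (fun z => A + B * z)); [|auto].
  assert (E : has_cderiv (fun z => A + B * z) (g t) (0 + B * 1)).
  { apply has_cderiv_plus; [apply has_cderiv_const|].
    apply has_cderiv_scal, has_cderiv_id. }
  replace (0 + B * 1) with B in E by ring. exact E.
Qed.

Lemma has_rderiv_ext (f g : R -> C) (t : R) (l m : C) :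
  (forall s, f s = g s) -> l = m -> has_rderiv f t l -> has_rderiv g t m.
Proof.
  intros E <-. apply is_derive_ext. exact E.
Qed.

Definition circ (r s : R) : C := RtoC r * expi s.

Lemma Cmod_circ (r s : R) : (0 <= r)%R -> Cmod (circ r s) = r.
Proof. intros H. unfold circ. rewrite Cmod_mult, Cmod_R, Cmod_expi, Rabs_pos_eq; lra. Qed.

Lemma circ_minus_ge (z0 : C) (r s : R) : (Cmod z0 < r)%R ->
  (r - Cmod z0 <= Cmod (circ r s - z0))%R.
Proof.
  intros H. pose proof (Cmod_ge_0 z0). pose proof (Cmod_triangle_rev (circ r s) z0).
  rewrite Cmod_circ in H1 by lra. lra.
Qed.

Lemma circ_minus_nz (z0 : C) (r s : R) : (Cmod z0 < r)%R -> circ r s - z0 <> 0.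
Proof. intros H. apply Cmod_gt_0. pose proof (circ_minus_ge z0 r s H). lra. Qed.

Lemma circ_nz (r s : R) : (0 < r)%R -> circ r s <> 0.
Proof. intros H. apply Cmod_gt_0. rewrite Cmod_circ; lra. Qed.

Lemma rcont_circ (r s : R) : rcont (circ r) s.
Proof. apply rcont_mult; [apply rcont_const|apply rcont_expi]. Qed.

(* The circles [z0 + t (circ r - z0)], [0 < t <= 1], shrink to [z0] without meeting it. *)
Lemma circle_deform (q : C -> C) (z0 : C) (r rho t1 : R) :
  (Cmod z0 < r)%R -> (r < rho)%R -> (0 < t1 <= 1)%R ->
  (forall z, (Cmod z < rho)%R -> z <> z0 -> exists l, has_cderiv q z l) ->
  CI (fun s => q (z0 + RtoC t1 * (circ r s - z0)) * (RtoC t1 * (Ci * circ r s))) 0 (2 * PI)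
  = CI (fun s => q (circ r s) * (Ci * circ r s)) 0 (2 * PI).
Proof.
  intros Hz Hr Ht1 Hq.
  pose proof (Cmod_ge_0 z0) as Hz0. pose proof PI_RGT_0 as HPI.
  pose (G := fun t s => z0 + RtoC t * (circ r s - z0)).
  pose (Gt := fun (t s : R) => circ r s - z0).
  pose (Gs := fun (t s : R) => RtoC t * (Ci * circ r s)).
  pose proof (goursat q G Gt Gs t1 1 0 (2 * PI) (2 * r)) as HG.
  (* By periodicity the two radial edges are the same path; once they cancel, Goursat's identity
     relates the two circles only. *)
  assert (H0 : CI (fun t => q (G t 0%R) * Gt t 0%R) t1 1
             = CI (fun t => q (G t (2 * PI)%R) * Gt t (2 * PI)%R) t1 1).
  { apply CI_ext; [lra|]. intros t _. unfold G, Gt, circ. now rewrite expi_period. }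
  rewrite H0 in HG. clear H0.
  assert (E1 : CI (fun s => q (circ r s) * (Ci * circ r s)) 0 (2 * PI)
    = CI (fun s => q (G 1%R s) * Gs 1%R s) 0 (2 * PI)).
  { apply CI_ext; [lra|]. intros s _. unfold G, Gs. f_equal; [f_equal|]; ring. }
  rewrite E1. clear E1.
  change (CI (fun s => q (G t1 s) * Gs t1 s) 0 (2 * PI)
    = CI (fun s => q (G 1%R s) * Gs 1%R s) 0 (2 * PI)).
  symmetry. apply Ceq_minus. rewrite <- HG; clear HG.
  - ring.
  - lra.
  - lra.
  - intros t s. unfold G, Gt.
    apply (has_rderiv_ext (fun t => z0 + (circ r s - z0) * RtoC t) _ _ ((circ r s - z0) * 1)).
    + intros u. ring.
    + ring.
    + apply has_rderiv_affine, has_rderiv_RtoC.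
  - intros t s. unfold G, Gs.
    apply (has_rderiv_ext (fun s => (z0 - RtoC t * z0) + (RtoC t * RtoC r) * expi s) _ _
      ((RtoC t * RtoC r) * (Ci * expi s))).
    + intros u. unfold circ. ring.
    + unfold circ. ring.
    + apply has_rderiv_affine, has_rderiv_expi.
  - intros t s. exact (rcont_const (circ r s - z0) t).
  - intros t s. apply rcont_mult; [apply rcont_const|].
    apply rcont_mult; [apply rcont_const|apply rcont_circ].
  - intros t s _ _. unfold Gt. eapply Rle_trans; [apply Cmod_minus_le|].
    rewrite Cmod_circ; lra.
  - intros t s Ht _. unfold Gs. rewrite !Cmod_mult, Cmod_R, Cmod_Ci, Cmod_circ, Rabs_pos_eq by lra.
    nra.
  - intros t s Ht _. apply Hq.
    + unfold G. replace (z0 + RtoC t * (circ r s - z0))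
        with (RtoC (1 - t) * z0 + RtoC t * circ r s) by (rewrite RtoC_minus; ring).
      eapply Rle_lt_trans; [apply Cmod_triangle|].
      rewrite !Cmod_mult, !Cmod_R, Cmod_circ, !Rabs_pos_eq by lra. nra.
    (* Here [t1 > 0] enters: no circle of the family reaches the possible singularity [z0]. *)
    + unfold G. intros E.
      assert (E' : RtoC t * (circ r s - z0) = 0).
      { replace (RtoC t * (circ r s - z0)) with (z0 + RtoC t * (circ r s - z0) - z0) by ring.
        rewrite E. ring. }
      revert E'. apply Cmult_neq_0; [apply RtoC_nz; lra|now apply circ_minus_nz].
Qed.

Section Cauchy.

Variables (h : C -> C) (rho : R).
Hypothesis Hh : forall z, (Cmod z < rho)%R -> exists l, has_cderiv h z l.

(** Cauchy's kernel [d zeta / (zeta - z0)] on [zeta = circ r s], where [d zeta = Ci * zeta ds]. *)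
Definition cker (z0 : C) (r s : R) : C := Ci * circ r s / (circ r s - z0).

Lemma rcont_cker (z0 : C) (r s : R) : (Cmod z0 < r)%R -> rcont (cker z0 r) s.
Proof.
  intros H. apply ctends_div; [now apply circ_minus_nz| |].
  - apply rcont_mult; [apply rcont_const|apply rcont_circ].
  - apply ctends_minus; [apply rcont_circ|apply ctends_const].
Qed.

Lemma Cmod_cker (z0 : C) (r s : R) : (Cmod z0 < r)%R ->
  (Cmod (cker z0 r s) <= r / (r - Cmod z0))%R.
Proof.
  intros H. pose proof (Cmod_ge_0 z0). unfold cker.
  rewrite Cmod_div, Cmod_mult, Cmod_Ci, Cmod_circ, Rmult_1_l by (lra || now apply circ_minus_nz).
  apply Rmult_le_compat_l; [lra|]. apply Rinv_le_contravar; [lra|now apply circ_minus_ge].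
Qed.

Lemma rcont_h_path (g : R -> C) (s : R) : (Cmod (g s) < rho)%R -> rcont g s ->
  rcont (fun s => h (g s)) s.
Proof. intros H Hg. destruct (Hh _ H) as [l Hl]. exact (rcont_comp _ _ _ _ Hl Hg). Qed.

Lemma rcont_h_circ (r s : R) : (0 <= r < rho)%R -> rcont (fun s => h (circ r s)) s.
Proof.
  intros H. apply rcont_h_path; [rewrite Cmod_circ; lra|apply rcont_circ].
Qed.

Lemma h_circ_bounded (r : R) : (0 <= r < rho)%R ->
  exists M, forall s, (0 <= s <= 2 * PI)%R -> (Cmod (h (circ r s)) <= M)%R.
Proof.
  intros H.
  destruct (bounded_continuity (V := C_R_NormedModule) (fun s => h (circ r s)) 0 (2 * PI))
    as [M HM].
  - intros s _. apply rcont_continuous, rcont_h_circ, H.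
  - exists M. intros s Hs. rewrite Cmod_norm. left. now apply HM.
Qed.

(** In [d zeta / (zeta - z0)] the dilation factor [t] cancels, so deforming the circle changes only
    the argument of [h], which tends to [z0] as [t] tends to 0. The integral of the kernel stays
    unevaluated until [CI_cker]. *)
Lemma cauchy_formula_ker (z0 : C) (r : R) : (Cmod z0 < r)%R -> (r < rho)%R ->
  CI (fun s => h (circ r s) * cker z0 r s) 0 (2 * PI) = h z0 * CI (cker z0 r) 0 (2 * PI).
Proof.
  intros Hz Hr. pose proof (Cmod_ge_0 z0) as Hz0. pose proof PI_RGT_0 as HPI.
  assert (Hpos : forall t s, (0 <= t <= 1)%R ->
    (Cmod (z0 + RtoC t * (circ r s - z0)) < rho)%R).
  { intros t s Ht. replace (z0 + RtoC t * (circ r s - z0))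
        with (RtoC (1 - t) * z0 + RtoC t * circ r s) by (rewrite RtoC_minus; ring).
    eapply Rle_lt_trans; [apply Cmod_triangle|].
    rewrite !Cmod_mult, !Cmod_R, Cmod_circ, !Rabs_pos_eq by lra. nra. }
  assert (Ct : forall t s, (0 <= t <= 1)%R ->
    rcont (fun s => h (z0 + RtoC t * (circ r s - z0)) * cker z0 r s) s).
  { intros t s Ht. apply rcont_mult; [|now apply rcont_cker].
    apply rcont_h_path; [now apply Hpos|].
    apply ctends_plus; [apply ctends_const|]. apply ctends_mult; [apply ctends_const|].
    apply ctends_minus; [apply rcont_circ|apply ctends_const]. }
  assert (Hconst : forall t, (0 < t <= 1)%R ->
    CI (fun s => h (z0 + RtoC t * (circ r s - z0)) * cker z0 r s) 0 (2 * PI) =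
    CI (fun s => h (circ r s) * cker z0 r s) 0 (2 * PI)).
  { intros t Ht.
    pose proof (circle_deform (fun z => h z / (z - z0)) z0 r rho t Hz Hr Ht) as HD.
    transitivity (CI (fun s => h (z0 + RtoC t * (circ r s - z0)) /
       (z0 + RtoC t * (circ r s - z0) - z0) * (RtoC t * (Ci * circ r s))) 0 (2 * PI)).
    - apply CI_ext; [lra|]. intros s _. unfold cker.
      pose proof (circ_minus_nz z0 r s Hz). assert (RtoC t <> 0) by (apply RtoC_nz; lra).
      replace (z0 + RtoC t * (circ r s - z0) - z0) with (RtoC t * (circ r s - z0)) by ring.
      field. auto.
    - rewrite HD.
      + apply CI_ext; [lra|]. intros s _. unfold cker.
        pose proof (circ_minus_nz z0 r s Hz). field. auto.
      + intros z Hz1 Hz2. destruct (Hh z Hz1) as [l Hl].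
        eexists. apply has_cderiv_mult; [exact Hl|].
        apply has_cderiv_inv; [now apply Cminus_eq_contra|].
        apply has_cderiv_minus; [apply has_cderiv_id|apply has_cderiv_const]. }
  set (J := CI (fun s => h (circ r s) * cker z0 r s) 0 (2 * PI)) in *.
  set (B := (r / (r - Cmod z0))%R).
  assert (HB : (0 < B)%R) by (apply Rdiv_lt_0_compat; lra).
  apply Ceq_minus, Cmod_eq_0, Rle_antisym; [|apply Cmod_ge_0].
  apply le_epsilon. intros eps He. rewrite Rplus_0_l.
  destruct (Hh z0 ltac:(lra)) as [l Hl]. apply has_cderiv_ctends in Hl.
  assert (HPB : (0 < 2 * PI * B)%R) by (apply Rmult_lt_0_compat; lra).
  destruct (Hl (eps / (2 * PI * B))%R) as [d [Hd Hnear]].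
  { apply Rdiv_lt_0_compat; lra. }
  (* Points of the circle are within [2 * r] of [z0]; the factor 4 makes the dilated distance at
     most [d / 2]. *)
  set (t := Rmin 1 (d / (4 * r))%R).
  assert (Ht : (0 < t <= 1)%R).
  { split; [|apply Rmin_l]. apply Rmin_glb_lt; [lra|]. apply Rdiv_lt_0_compat; lra. }
  assert (Htd : (t * (2 * r) < d)%R).
  { assert (t <= d / (4 * r))%R by apply Rmin_r.
    apply (Rmult_le_compat_r (2 * r)) in H; [|lra].
    replace (d / (4 * r) * (2 * r))%R with (d / 2)%R in H by (field; lra). lra. }
  rewrite <- (Hconst t Ht), <- CI_scal by (lra || intros s _; now apply rcont_cker).
  rewrite <- CI_minus.
  - replace eps with ((2 * PI - 0) * (eps / (2 * PI * B) * B))%R by (field; lra).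
    apply Cmod_CI_le; [lra| |].
    + intros s _. apply ctends_minus; [apply Ct; lra|].
      apply ctends_mult; [apply ctends_const|now apply rcont_cker].
    + intros s _.
      replace (h (z0 + RtoC t * (circ r s - z0)) * cker z0 r s - h z0 * cker z0 r s)
        with ((h (z0 + RtoC t * (circ r s - z0)) - h z0) * cker z0 r s) by ring.
      rewrite Cmod_mult. apply Rmult_le_compat; try apply Cmod_ge_0; [|now apply Cmod_cker].
      left. apply Hnear. replace (z0 + RtoC t * (circ r s - z0) - z0)
        with (RtoC t * (circ r s - z0)) by ring.
      rewrite Cmod_mult, Cmod_R, Rabs_pos_eq by lra.
      eapply Rle_lt_trans; [|exact Htd]. apply Rmult_le_compat_l; [lra|].
      eapply Rle_trans; [apply Cmod_minus_le|]. rewrite Cmod_circ; lra.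
  - lra.
  - intros s _. apply Ct. lra.
  - intros s _. apply ctends_mult; [apply ctends_const|now apply rcont_cker].
Qed.

(** The integral of [h zeta / zeta ^ (n + 1)] over the circle, that is [2 PI i] times the Taylor
    coefficient: the factor [zeta] in [d zeta = Ci * zeta ds] absorbs one power. *)
Definition ccoef (r : R) (n : nat) : C :=
  CI (fun s => Ci * h (circ r s) * (/ circ r s) ^ n) 0 (2 * PI).

Lemma rcont_circ_invpow (r s : R) (n : nat) : (0 < r)%R ->
  rcont (fun s => (/ circ r s) ^ n) s.
Proof.
  intros H. apply ctends_pow, ctends_inv; [now apply circ_nz|apply rcont_circ].
Qed.

Lemma ccoef_cont (r s : R) (n : nat) : (0 < r < rho)%R ->
  rcont (fun s => Ci * h (circ r s) * (/ circ r s) ^ n) s.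
Proof.
  intros H. apply rcont_mult; [|now apply rcont_circ_invpow].
  apply rcont_mult; [apply rcont_const|apply rcont_h_circ; lra].
Qed.

(** Finite geometric expansion from [zeta / (zeta - z0) = 1 + (z0 / zeta) * (zeta / (zeta - z0))].
    Keeping the remainder as an integral avoids exchanging a series with an integral. *)
Lemma cauchy_partial_sum (z0 : C) (r : R) (N : nat) : (Cmod z0 < r)%R -> (r < rho)%R ->
  CI (fun s => h (circ r s) * cker z0 r s) 0 (2 * PI) =
  sum_n (fun n => ccoef r n * z0 ^ n) N +
  CI (fun s => h (circ r s) * (cker z0 r s * (z0 * / circ r s) ^ S N)) 0 (2 * PI).
Proof.
  intros Hz Hr. pose proof (Cmod_ge_0 z0) as Hz0. pose proof PI_RGT_0 as HPI.
  assert (Step : forall n,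
    CI (fun s => h (circ r s) * (cker z0 r s * (z0 * / circ r s) ^ n)) 0 (2 * PI) =
    ccoef r n * z0 ^ n +
    CI (fun s => h (circ r s) * (cker z0 r s * (z0 * / circ r s) ^ S n)) 0 (2 * PI)).
  { intros n. unfold ccoef. rewrite (Cmult_comm (CI _ _ _)), <- CI_scal.
    2: lra. 2: intros s _; apply ccoef_cont; lra.
    rewrite <- CI_plus.
    - apply CI_ext; [lra|]. intros s _. rewrite Cpow_S, Cpow_mult_l. unfold cker.
      pose proof (circ_minus_nz z0 r s Hz). assert (circ r s <> 0) by (apply circ_nz; lra).
      field. auto.
    - lra.
    - intros s _. apply rcont_mult; [apply rcont_const|apply ccoef_cont; lra].
    - intros s _. apply rcont_mult; [apply rcont_h_circ; lra|].
      apply rcont_mult; [now apply rcont_cker|]. apply ctends_pow.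
      apply ctends_mult; [apply ctends_const|].
      apply ctends_inv; [apply circ_nz; lra|apply rcont_circ]. }
  induction N as [|N IH].
  - rewrite sum_n_O_C, <- Step. apply CI_ext; [lra|]. intros s _. simpl. ring.
  - rewrite IH, sum_n_S_C, Step. ring.
Qed.

Lemma cauchy_series_ker (z0 : C) (r : R) : (Cmod z0 < r)%R -> (r < rho)%R ->
  ctends eventually (sum_n (fun n => ccoef r n * z0 ^ n))
    (h z0 * CI (cker z0 r) 0 (2 * PI)).
Proof.
  intros Hz Hr. pose proof (Cmod_ge_0 z0) as Hz0. pose proof PI_RGT_0 as HPI.
  rewrite <- cauchy_formula_ker by auto.
  destruct (h_circ_bounded r) as [M HM]; [lra|].
  assert (HM0 : (0 <= M)%R).
  { eapply Rle_trans; [apply Cmod_ge_0|]. apply (HM 0%R). lra. }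
  set (B := (r / (r - Cmod z0))%R).
  assert (HB : (0 < B)%R) by (apply Rdiv_lt_0_compat; lra).
  set (K := ((2 * PI - 0) * (M * B) + 1)%R).
  assert (HK0 : (0 <= (2 * PI - 0) * (M * B))%R).
  { apply Rmult_le_pos; [lra|]. apply Rmult_le_pos; lra. }
  assert (HK : (0 < K)%R) by (unfold K; lra).
  set (x := (Cmod z0 / r)%R).
  assert (Hx : (0 <= x < 1)%R).
  { unfold x. split; [apply Rmult_le_pos; [lra|left; apply Rinv_0_lt_compat; lra]|].
    apply (Rmult_lt_reg_r r); [lra|]. unfold Rdiv. rewrite Rmult_assoc, Rinv_l; lra. }
  intros eps He.
  destruct (pow_lt_1_zero x ltac:(rewrite Rabs_pos_eq; lra) (eps / K)%R) as [N HN].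
  { apply Rdiv_lt_0_compat; lra. }
  exists N. intros n Hn. rewrite Cmod_minus_sym, (cauchy_partial_sum z0 r n) by auto.
  match goal with |- (Cmod (?S + ?I - ?S) < _)%R => replace (S + I - S) with I by ring end.
  specialize (HN (S n) ltac:(lia)). rewrite Rabs_pos_eq in HN by (apply pow_le; lra).
  assert (HxK : (x ^ S n * K < eps)%R).
  { apply (Rmult_lt_compat_r K) in HN; [|lra].
    replace (eps / K * K)%R with eps in HN by (field; lra). auto. }
  assert (Hxn : (0 <= x ^ S n)%R) by (apply pow_le; lra).
  apply Rle_lt_trans with ((2 * PI - 0) * (M * (B * x ^ S n)))%R.
  2:{ unfold K in HxK. nra. }
  apply Cmod_CI_le; [lra| |].
  - intros s _. apply rcont_mult; [apply rcont_h_circ; lra|].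
    apply rcont_mult; [now apply rcont_cker|]. apply ctends_pow.
    apply ctends_mult; [apply ctends_const|].
    apply ctends_inv; [apply circ_nz; lra|apply rcont_circ].
  - intros s Hs. rewrite !Cmod_mult, Cmod_pow, Cmod_mult, Cmod_inv, Cmod_circ
      by (lra || apply circ_nz; lra).
    apply Rmult_le_compat; try apply Cmod_ge_0; [|now apply HM|].
    + apply Rmult_le_pos; [apply Cmod_ge_0|]. exact Hxn.
    + apply Rmult_le_compat_r; [exact Hxn|now apply Cmod_cker].
Qed.

(** The expansion at [z] needs a circle enclosing [z], whereas Taylor's theorem wants one sequence
    for the whole disc. [circle_deform] with centre 0, applied to [h z / z ^ S n], reconciles the
    two. *)
Lemma ccoef_indep (r r' : R) (n : nat) : (0 < r' <= r)%R -> (r < rho)%R ->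
  ccoef r' n = ccoef r n.
Proof.
  intros Hr' Hr. pose proof PI_RGT_0 as HPI.
  assert (Hn : forall z : C, z <> 0 -> z ^ S n <> 0) by (intros z; apply Cpow_nz).
  assert (Hc : forall z w : C, z <> 0 ->
    w / z ^ S n * (Ci * z) = Ci * w * (/ z) ^ n).
  { intros z w Hz. rewrite Cpow_inv, Cpow_S by auto. field. split; [now apply Cpow_nz|auto]. }
  assert (Ht : (0 < r' / r <= 1)%R).
  { split; [apply Rdiv_lt_0_compat; lra|]. apply (Rmult_le_reg_r r); [lra|].
    unfold Rdiv. rewrite Rmult_assoc, Rinv_l; lra. }
  pose proof (circle_deform (fun z => h z / z ^ S n) 0 r rho (r' / r)) as HD.
  rewrite Cmod_0 in HD. specialize (HD ltac:(lra) Hr Ht).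
  assert (E : forall s, RtoC (r' / r) * circ r s = circ r' s).
  { intros s. unfold circ. rewrite RtoC_div by lra. field. apply RtoC_nz. lra. }
  transitivity (CI (fun s => h (0 + RtoC (r' / r) * (circ r s - 0)) /
    (0 + RtoC (r' / r) * (circ r s - 0)) ^ S n * (RtoC (r' / r) * (Ci * circ r s))) 0 (2 * PI)).
  - apply CI_ext; [lra|]. intros s _.
    replace (0 + RtoC (r' / r) * (circ r s - 0)) with (circ r' s) by (rewrite <- E; ring).
    replace (RtoC (r' / r) * (Ci * circ r s)) with (Ci * circ r' s) by (rewrite <- E; ring).
    symmetry. apply Hc. apply circ_nz. lra.
  - rewrite HD.
    + apply CI_ext; [lra|]. intros s _. apply Hc. apply circ_nz. lra.
    + intros z Hz1 Hz2. destruct (Hh z Hz1) as [l Hl].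
      destruct (has_cderiv_pow _ _ _ (S n) (has_cderiv_id z)) as [m Hm].
      eexists. apply has_cderiv_mult; [exact Hl|]. apply has_cderiv_inv; [now apply Hn|exact Hm].
Qed.

End Cauchy.

Lemma ctends_eventually_const (u : nat -> C) (l : C) :
  (forall n, u n = l) -> ctends eventually u l.
Proof.
  intros H. apply (ctends_ext (fun _ => l)); [|apply ctends_const].
  apply filter_forall. intros n. now rewrite H.
Qed.

Lemma has_rderiv_expi_neg (k s : R) :
  has_rderiv (fun s => expi (- (k * s))) s (- (RtoC k * Ci) * expi (- (k * s))).
Proof.
  replace (- (RtoC k * Ci) * expi (- (k * s)))
    with ((k * sin (- (k * s)))%R, (- k * cos (- (k * s)))%R).
  - apply has_rderiv_pair; auto_derive; auto; ring.
  - unfold RtoC, Ci, expi, Cmult, Copp; simpl. f_equal; ring.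
Qed.

Lemma circ_invpow (r s : R) (n : nat) : (0 < r)%R ->
  (/ circ r s) ^ n = (/ RtoC r) ^ n * expi (- (INR n * s)).
Proof.
  intros H. pose proof (RtoC_nz r (Rgt_not_eq _ _ H)) as Hr.
  assert (E : / circ r s = / RtoC r * expi (- s)).
  { assert (Hs : expi s * expi (- s) = 1).
    { rewrite <- expi_plus. replace (s + - s)%R with 0%R by ring.
      unfold expi. now rewrite cos_0, sin_0. }
    unfold circ. pose proof (expi_nz s).
    replace (expi (- s)) with (expi s * expi (- s) / expi s) by (field; auto).
    rewrite Hs. field. auto. }
  rewrite E, Cpow_mult_l. f_equal. clear.
  induction n as [|n IH].
  - simpl. rewrite Rmult_0_l, Ropp_0. unfold expi. now rewrite cos_0, sin_0.
  - rewrite Cpow_S, IH, <- expi_plus. f_equal. rewrite S_INR. ring.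
Qed.

Lemma ccoef_const (r : R) (n : nat) : (0 < r)%R ->
  ccoef (fun _ => 1) r n = match n with O => Ci * RtoC (2 * PI) | S _ => 0 end.
Proof.
  intros Hr. pose proof PI_RGT_0 as HPI. unfold ccoef. destruct n as [|n].
  - rewrite (CI_deriv (fun s => 0 + Ci * RtoC s)).
    + rewrite RtoC_mult. ring.
    + lra.
    + intros s _. replace (Ci * 1 * (/ circ r s) ^ 0) with (Ci * 1) by (simpl; ring).
      apply has_rderiv_affine, has_rderiv_RtoC.
    + intros s _. apply rcont_mult; [apply rcont_const|now apply rcont_circ_invpow].
  - set (k := INR (S n)).
    assert (Hk : RtoC k <> 0) by (apply RtoC_nz, not_0_INR; discriminate).
    (* For a nonzero integer [k] this primitive has period [2 PI], so the integral over a full turn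
       vanishes. *)
    rewrite (CI_deriv (fun s => 0 + (- / RtoC k * (/ RtoC r) ^ S n) * expi (- (k * s)))).
    + replace (expi (- (k * (2 * PI)))) with (expi (- (k * 0))); [ring|].
      unfold expi. rewrite Rmult_0_r, Ropp_0, !cos_neg, !sin_neg, cos_0, sin_0.
      pose proof (cos_period 0 (S n)) as H1. pose proof (sin_period 0 (S n)) as H2.
      replace (k * (2 * PI))%R with (0 + 2 * INR (S n) * PI)%R by (unfold k; ring).
      rewrite H1, H2, cos_0, sin_0, Ropp_0. auto.
    + lra.
    + intros s _. rewrite circ_invpow by auto.
      eapply has_rderiv_ext; [reflexivity| |apply has_rderiv_affine, has_rderiv_expi_neg].
      fold k. field. auto.
    + intros s _. apply rcont_mult; [apply rcont_const|now apply rcont_circ_invpow].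
Qed.

(** Read off from the expansion of the constant function 1, of which only the term of index 0
    survives; no logarithm is involved. *)
Lemma CI_cker (z0 : C) (r : R) : (Cmod z0 < r)%R ->
  CI (cker z0 r) 0 (2 * PI) = Ci * RtoC (2 * PI).
Proof.
  intros Hz. pose proof (Cmod_ge_0 z0) as Hz0.
  pose proof (cauchy_series_ker (fun _ => 1) (r + 1)
    (fun z _ => ex_intro _ _ (has_cderiv_const 1 z)) z0 r Hz ltac:(lra)) as H.
  rewrite Cmult_1_l in H. apply (ctends_unique _ _ _ H).
  apply ctends_eventually_const. intros n. induction n as [|n IH].
  - rewrite sum_n_O_C, ccoef_const by lra. simpl. ring.
  - rewrite sum_n_S_C, IH, ccoef_const by lra. ring.
Qed.

Lemma Ci2PI_nz : Ci * RtoC (2 * PI) <> 0.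
Proof.
  pose proof PI_RGT_0. apply Cmult_neq_0; [apply Ci_nz|apply RtoC_nz; lra].
Qed.

Theorem taylor (h : C -> C) (rho : R) : (0 < rho)%R ->
  (forall z, (Cmod z < rho)%R -> exists l, has_cderiv h z l) ->
  exists a : nat -> C, forall z, (Cmod z < rho)%R ->
    ctends eventually (sum_n (fun n => a n * z ^ n)) (h z).
Proof.
  intros Hrho Hh. pose proof Ci2PI_nz as HT. set (T := Ci * RtoC (2 * PI)) in *.
  exists (fun n => / T * ccoef h (rho / 2) n). intros z Hz.
  pose proof (Cmod_ge_0 z) as Hz0.
  (* The circle must enclose [z] and be no smaller than the reference circle of radius [rho / 2]
     that fixes the coefficients. *)
  set (r := Rmax (rho / 2) ((Cmod z + rho) / 2)%R).
  assert (Hr : (rho / 2 <= r /\ Cmod z < r /\ r < rho)%R).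
  { unfold r. split; [apply Rmax_l|]. split.
    - eapply Rlt_le_trans; [|apply Rmax_r]. lra.
    - apply Rmax_lub_lt; lra. }
  pose proof (cauchy_series_ker h rho Hh z r ltac:(lra) ltac:(lra)) as H.
  rewrite CI_cker in H by lra. fold T in H.
  replace (h z) with (/ T * (h z * T)) by (field; auto).
  apply (ctends_ext (fun n => / T * sum_n (fun n => ccoef h r n * z ^ n) n)).
  - apply filter_forall. intros n. induction n as [|n IH].
    + rewrite !sum_n_O_C, (ccoef_indep h rho Hh r (rho / 2)) by lra. ring.
    + rewrite !sum_n_S_C, <- IH, (ccoef_indep h rho Hh r (rho / 2)) by lra. ring.
  - apply ctends_mult; [apply ctends_const|auto].
Qed.

Lemma cauchy_bound (h : C -> C) (rho r M : R) (z0 : C) :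
  (forall z, (Cmod z < rho)%R -> exists l, has_cderiv h z l) ->
  (Cmod z0 < r)%R -> (r < rho)%R ->
  (forall z, Cmod z = r -> (Cmod (h z) <= M)%R) ->
  (Cmod (h z0) <= r / (r - Cmod z0) * M)%R.
Proof.
  intros Hh Hz Hr HM. pose proof (Cmod_ge_0 z0) as Hz0. pose proof PI_RGT_0 as HPI.
  pose proof (cauchy_formula_ker h rho Hh z0 r Hz Hr) as H. rewrite CI_cker in H by auto.
  apply (Rmult_le_reg_l (2 * PI)); [lra|].
  replace (2 * PI * Cmod (h z0))%R with (Cmod (h z0 * (Ci * RtoC (2 * PI)))).
  2:{ rewrite !Cmod_mult, Cmod_Ci, Cmod_R, Rabs_pos_eq by lra. ring. }
  rewrite <- H.
  replace (2 * PI * (r / (r - Cmod z0) * M))%R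
    with ((2 * PI - 0) * (M * (r / (r - Cmod z0))))%R by (field; lra).
  apply Cmod_CI_le; [lra| |].
  - intros s _. apply rcont_mult; [|now apply rcont_cker].
    apply (rcont_h_circ h rho Hh). lra.
  - intros s _. rewrite Cmod_mult. apply Rmult_le_compat; try apply Cmod_ge_0.
    + apply HM. apply Cmod_circ. lra.
    + now apply Cmod_cker.
Qed.

(** * Complex power series *)

Definition pser (a : nat -> C) (h : C -> C) (rho : R) : Prop :=
  forall z, (Cmod z < rho)%R -> ctends eventually (sum_n (fun n => a n * z ^ n)) (h z).

Definition Dps (a : nat -> C) (n : nat) : C := RtoC (INR (S n)) * a (S n).

Lemma ctends_series_bounded (u : nat -> C) (l : C) :
  ctends eventually (sum_n u) l -> exists M, forall n, (Cmod (u n) <= M)%R.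
Proof.
  intros H. apply is_series_ctends in H.
  destruct (filterlim_bounded (sum_n u) (ex_intro _ l H)) as [M HM].
  assert (HM' : forall n, (Cmod (sum_n u n) <= M)%R) by exact HM.
  assert (0 <= M)%R by (eapply Rle_trans; [apply Cmod_ge_0|apply (HM' O)]).
  exists (M + M)%R. intros [|n].
  - rewrite <- sum_n_O_C. specialize (HM' O). lra.
  - replace (u (S n)) with (sum_n u (S n) - sum_n u n) by (rewrite sum_n_S_C; ring).
    eapply Rle_trans; [apply Cmod_minus_le|]. apply Rplus_le_compat; apply HM'.
Qed.

(** Passing to moduli lets the real theory of the radius of convergence supply absolute convergence
    of the series and of its derived series. *)
Lemma pser_radius (a : nat -> C) (h : C -> C) (rho r : R) : pser a h rho ->
  (0 <= r < rho)%R -> Rbar_lt r (CV_radius (fun n => Cmod (a n))).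
Proof.
  intros H Hr. set (r' := ((r + rho) / 2)%R).
  assert (Hr' : (r < r' < rho)%R) by (unfold r'; lra).
  assert (Hz : Cmod (RtoC r') = r') by (rewrite Cmod_R, Rabs_pos_eq; lra).
  destruct (ctends_series_bounded _ _ (H (RtoC r') ltac:(lra))) as [M HM].
  apply Rbar_lt_le_trans with (Finite r'); [simpl; lra|].
  apply (proj1 (CV_radius_bounded (fun n => Cmod (a n)))).
  exists M. intros n. specialize (HM n). rewrite Cmod_mult, Cmod_pow, Hz in HM.
  rewrite Rabs_pos_eq; auto. apply Rmult_le_pos; [apply Cmod_ge_0|apply pow_le; lra].
Qed.

Lemma ex_series_C_le (u : nat -> C) (b : nat -> R) :
  (forall n, (Cmod (u n) <= b n)%R) -> ex_series b ->
  exists l, ctends eventually (sum_n u) l.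
Proof.
  intros H Hb.
  destruct (@ex_series_le C_AbsRing C_CompleteNormedModule u b H Hb) as [l Hl].
  exists l. now apply is_series_ctends.
Qed.

Lemma partial_sum_bounded (b : nat -> R) : (forall n, (0 <= b n)%R) -> ex_series b ->
  exists K, forall n, (sum_n b n <= K)%R.
Proof.
  intros Hb [K HK]. exists K. intros n.
  apply (is_lim_seq_incr_compare (sum_n b)); [exact HK|].
  intros m. rewrite sum_Sn. unfold plus; simpl. specialize (Hb (S m)). lra.
Qed.

(** By induction, multiplying by [y]. The factor 1/2 of Taylor's remainder is given away so that the
    constants match the second derived series at [s]. *)
Lemma pow_second_diff (y z : C) (s : R) (n : nat) :
  (Cmod y <= s)%R -> (Cmod z <= s)%R ->
  (Cmod (y ^ S (S n) - z ^ S (S n) - (y - z) * (RtoC (INR (S (S n))) * z ^ S n))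
   <= INR (S n) * INR (S (S n)) * s ^ n * (Cmod (y - z) * Cmod (y - z)))%R.
Proof.
  intros Hy Hz. pose proof (Cmod_ge_0 y). pose proof (Cmod_ge_0 z).
  set (w := (Cmod (y - z) * Cmod (y - z))%R).
  assert (Hw : (0 <= w)%R) by (apply Rmult_le_pos; apply Cmod_ge_0).
  induction n as [|n IH].
  - replace (y ^ 2 - z ^ 2 - (y - z) * (RtoC (INR 2) * z ^ 1)) with ((y - z) * (y - z)).
    + rewrite Cmod_mult. fold w. simpl. lra.
    + simpl. rewrite RtoC_plus. ring.
  - replace (y ^ S (S (S n)) - z ^ S (S (S n))
        - (y - z) * (RtoC (INR (S (S (S n)))) * z ^ S (S n)))
      with (y * (y ^ S (S n) - z ^ S (S n) - (y - z) * (RtoC (INR (S (S n))) * z ^ S n))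
        + RtoC (INR (S (S n))) * z ^ S n * ((y - z) * (y - z))).
    2:{ rewrite (S_INR (S (S n))), RtoC_plus, !(Cpow_S _ (S (S n))), !(Cpow_S z (S n)). ring. }
    eapply Rle_trans; [apply Cmod_triangle|].
    rewrite !Cmod_mult, Cmod_pow, Cmod_R, Rabs_pos_eq by apply pos_INR. fold w.
    assert (Hs : (0 <= s)%R) by lra.
    assert (H1 := Rmult_le_compat _ _ _ _ H (Cmod_ge_0 _) Hy IH).
    assert (H2 : (Cmod z ^ S n <= s ^ S n)%R) by (apply pow_incr; lra).
    assert (Hn : (0 <= INR (S n))%R) by apply pos_INR.
    assert (H3 : (INR (S (S n)) * Cmod z ^ S n * w <= INR (S (S n)) * s ^ S n * w)%R).
    { apply Rmult_le_compat_r; [auto|]. apply Rmult_le_compat_l; [apply pos_INR|auto]. }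
    assert (H4 : (0 <= INR (S (S n)) * s ^ S n * w)%R).
    { apply Rmult_le_pos; [|auto]. apply Rmult_le_pos; [apply pos_INR|apply pow_le; auto]. }
    eapply Rle_trans; [apply Rplus_le_compat; [exact H1|exact H3]|].
    rewrite (S_INR (S (S n))), (S_INR (S n)) in *.
    change (s ^ S n)%R with (s * s ^ n)%R in *.
    assert (E : ((INR (S n) + 1) * ((INR (S n) + 1) + 1) * (s * s ^ n) * w
      = s * (INR (S n) * (INR (S n) + 1) * s ^ n * w)
        + 2 * ((INR (S n) + 1) * (s * s ^ n) * w))%R) by ring.
    rewrite E. lra.
Qed.

Lemma sum_n_first_order (a : nat -> C) (y z : C) (n : nat) :
  sum_n (fun n => a n * y ^ n) (S n) - sum_n (fun n => a n * z ^ n) (S n)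
    - (y - z) * sum_n (fun n => Dps a n * z ^ n) n
  = sum_n (fun n => a (S n) * (y ^ S n - z ^ S n - (y - z) * (RtoC (INR (S n)) * z ^ n))) n.
Proof.
  induction n as [|n IH].
  - rewrite !sum_n_S_C, !sum_n_O_C. unfold Dps. simpl. ring.
  - rewrite (sum_n_S_C _ (S n)), (sum_n_S_C (fun n => a n * z ^ n) (S n)),
      (sum_n_S_C (fun n => Dps a n * z ^ n) n),
      (sum_n_S_C (fun n => a (S n) * _) n), <- IH.
    unfold Dps. ring.
Qed.

Lemma Cmod_sum_n_le (u : nat -> C) (b : nat -> R) (n : nat) :
  (forall k, (Cmod (u k) <= b k)%R) -> (Cmod (sum_n u n) <= sum_n b n)%R.
Proof.
  intros H. induction n as [|n IH].
  - rewrite sum_n_O_C, sum_O. apply H.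
  - rewrite sum_n_S_C, sum_Sn. eapply Rle_trans; [apply Cmod_triangle|].
    apply Rplus_le_compat; [exact IH|apply H].
Qed.

Lemma ctends_eventually_S (u : nat -> C) (l : C) :
  ctends eventually u l -> ctends eventually (fun n => u (S n)) l.
Proof.
  intros H eps He. destruct (H eps He) as [N HN]. exists N. intros n Hn. apply HN. lia.
Qed.

Lemma ctends_eventually_S_inv (u : nat -> C) (l : C) :
  ctends eventually (fun n => u (S n)) l -> ctends eventually u l.
Proof.
  intros H eps He. destruct (H eps He) as [N HN]. exists (S N). intros [|n] Hn; [lia|].
  apply HN. lia.
Qed.

(** Subtracting the derived series term by term leaves second-order errors, majorised by the second
    derived series of the moduli at a radius [s] between [Cmod z] and [rho]. *)
Lemma pser_derive_at (a : nat -> C) (h : C -> C) (rho : R) (z : C) : pser a h rho ->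
  (Cmod z < rho)%R ->
  exists l, ctends eventually (sum_n (fun n => Dps a n * z ^ n)) l /\ has_cderiv h z l.
Proof.
  intros Hp Hz. pose proof (Cmod_ge_0 z) as Hz0.
  set (A := fun n => Cmod (a n)).
  set (s := ((Cmod z + rho) / 2)%R).
  assert (Hs : (Cmod z < s < rho)%R) by (unfold s; lra).
  destruct (ex_series_C_le (fun n => Dps a n * z ^ n)
    (fun n => Rabs (PS_derive A n * Cmod z ^ n))) as [l Hl].
  { intros n. rewrite Cmod_mult, Cmod_pow, Rabs_mult, (Rabs_pos_eq (_ ^ _)) by (apply pow_le; lra).
    apply Rmult_le_compat_r; [apply pow_le; lra|]. unfold Dps, PS_derive, A.
    rewrite Cmod_mult, Rabs_mult, Cmod_R, (Rabs_pos_eq (Cmod _)) by apply Cmod_ge_0. lra. }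
  { apply CV_disk_inside. rewrite Rabs_pos_eq, CV_radius_derive by lra.
    apply (pser_radius a h rho); auto. }
  exists l. split; [exact Hl|].
  set (b := fun n => (PS_derive (PS_derive A) n * s ^ n)%R).
  assert (Hb : forall n, (0 <= b n)%R).
  { intros n. unfold b, PS_derive, A.
    repeat apply Rmult_le_pos; try apply pos_INR; [apply Cmod_ge_0|apply pow_le; lra]. }
  destruct (partial_sum_bounded b Hb) as [K HK].
  { apply (ex_series_ext (fun n => Rabs (b n))); [intros n; apply Rabs_pos_eq, Hb|].
    apply CV_disk_inside. rewrite Rabs_pos_eq, !CV_radius_derive by lra.
    apply (pser_radius a h rho); auto. lra. }
  assert (HK0 : (0 <= K)%R).
  { eapply Rle_trans; [apply (Hb O)|]. rewrite <- (sum_O b). apply HK. }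
  assert (Main : forall y, (Cmod y < s)%R ->
    (Cmod (h y - h z - (y - z) * l) <= K * (Cmod (y - z) * Cmod (y - z)))%R).
  { intros y Hy.
    assert (T : ctends eventually
       (fun n => sum_n (fun n => a n * y ^ n) (S n) - sum_n (fun n => a n * z ^ n) (S n)
         - (y - z) * sum_n (fun n => Dps a n * z ^ n) n) (h y - h z - (y - z) * l)).
    { apply ctends_minus.
      - apply ctends_minus.
        + apply (ctends_eventually_S (sum_n (fun n => a n * y ^ n))), Hp. lra.
        + apply (ctends_eventually_S (sum_n (fun n => a n * z ^ n))), Hp. lra.
      - apply ctends_mult; [apply ctends_const|exact Hl]. }
    apply ctends_eventually_S in T.
    apply (ctends_le _ _ _ T). apply filter_forall. intros n.
    rewrite sum_n_first_order.
    set (u := fun n => a (S n) * (y ^ S n - z ^ S n - (y - z) * (RtoC (INR (S n)) * z ^ n))).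
    set (w := (Cmod (y - z) * Cmod (y - z))%R).
    assert (Hw : (0 <= w)%R) by (apply Rmult_le_pos; apply Cmod_ge_0).
    (* The term of index 0 comes from the linear monomial and vanishes; [pow_second_diff] starts at
       exponent 2. *)
    assert (E : sum_n u (S n) = sum_n (fun n => u (S n)) n).
    { clear. induction n as [|n IH].
      - rewrite sum_n_S_C, !sum_n_O_C. unfold u at 1. simpl. ring.
      - now rewrite (sum_n_S_C u), IH, sum_n_S_C. }
    rewrite E.
    apply Rle_trans with (sum_n (fun n => b n * w)%R n).
    - apply Cmod_sum_n_le. intros k. unfold u. rewrite Cmod_mult.
      eapply Rle_trans.
      + apply Rmult_le_compat_l; [apply Cmod_ge_0|].
        apply (pow_second_diff y z s k); lra.
      + fold w. unfold b, PS_derive, A. right. ring.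
    - replace (sum_n (fun n => b n * w)%R n) with (sum_n b n * w)%R
        by (symmetry; exact (sum_n_mult_r (K := R_Ring) w b n)).
      apply Rmult_le_compat_r; auto. }
  apply has_cderiv_iff. intros eps He.
  assert (Hd : (0 < eps / (K + 1))%R) by (apply Rdiv_lt_0_compat; lra).
  assert (Hn : cnbhs z (fun y => (Cmod (y - z) < eps / (K + 1))%R)).
  { exists (eps / (K + 1))%R. auto. }
  generalize (filter_and _ _ (cnbhs_disc z s (proj1 Hs)) Hn). apply filter_imp.
  intros y [Hy1 Hy2]. eapply Rle_trans; [now apply Main|].
  rewrite <- Rmult_assoc. apply Rmult_le_compat_r; [apply Cmod_ge_0|].
  pose proof (Cmod_ge_0 (y - z)).
  apply (Rmult_lt_compat_r (K + 1)) in Hy2; [|lra].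
  replace (eps / (K + 1) * (K + 1))%R with eps in Hy2 by (field; lra). nra.
Qed.

Lemma pser_derive (a : nat -> C) (h : C -> C) (rho : R) : pser a h rho ->
  pser (Dps a) (C_derive h) rho /\
  forall z, (Cmod z < rho)%R -> has_cderiv h z (C_derive h z).
Proof.
  intros H. split; intros z Hz; destruct (pser_derive_at a h rho z H Hz) as [l [H1 H2]];
    rewrite (is_C_derive_unique _ _ _ H2); auto.
Qed.

Lemma pser_0 (a : nat -> C) (h : C -> C) (rho : R) : (0 < rho)%R -> pser a h rho -> h 0 = a O.
Proof.
  intros Hr H. specialize (H 0). rewrite Cmod_0 in H. specialize (H Hr).
  apply (ctends_unique _ _ _ H). apply ctends_eventually_const.
  intros n. induction n as [|n IH].
  - rewrite sum_n_O_C. simpl. ring.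
  - rewrite sum_n_S_C, IH. simpl. ring.
Qed.

Lemma sum_n_shift (a : nat -> C) (z : C) (n : nat) :
  sum_n (fun n => a n * z ^ n) (S n) = a O + z * sum_n (fun n => a (S n) * z ^ n) n :> C.
Proof.
  induction n as [|n IH].
  - rewrite sum_n_S_C, !sum_n_O_C. simpl. ring.
  - rewrite sum_n_S_C, IH, sum_n_S_C, (Cpow_S z (S n)). ring.
Qed.

(** Shifting the coefficients removes the singularity of [(h z - a O) / z] at 0. *)
Lemma pser_quotient (a : nat -> C) (h : C -> C) (rho : R) : pser a h rho ->
  exists k, pser (fun n => a (S n)) k rho /\
    forall z, (Cmod z < rho)%R -> h z = a O + z * k z.
Proof.
  intros H. exists (fun z => if Ceq_dec z 0 then a 1%nat else (h z - a O) / z).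
  split; intros z Hz; destruct (Ceq_dec z 0) as [->|Nz].
  - apply ctends_eventually_const. intros n. induction n as [|n IH].
    + rewrite sum_n_O_C. simpl. ring.
    + rewrite sum_n_S_C, IH. simpl. ring.
  - apply (ctends_ext (fun n => (sum_n (fun n => a n * z ^ n) (S n) - a O) / z)).
    + apply filter_forall. intros n. rewrite sum_n_shift. field. auto.
    + apply ctends_div; [auto| |apply ctends_const].
      apply ctends_minus; [|apply ctends_const].
      apply (ctends_eventually_S (sum_n (fun n => a n * z ^ n))), H, Hz.
  - rewrite (pser_0 a h rho); auto; [ring|]. now rewrite Cmod_0 in Hz.
  - field. auto.
Qed.

(** Dividing coefficients by [S n] keeps them dominated by the old moduli, so the integrated series
    converges on the same disc, and termwise differentiation returns the original one. *)
Lemma pser_primitive (a : nat -> C) (h : C -> C) (rho : R) : pser a h rho ->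
  exists H, forall z, (Cmod z < rho)%R -> has_cderiv H z (h z).
Proof.
  intros Hp.
  set (A := fun n => match n with O => RtoC 0 | S m => a m / RtoC (INR (S m)) end).
  assert (Hn : forall n, RtoC (INR (S n)) <> 0).
  { intros n. apply RtoC_nz, not_0_INR. discriminate. }
  assert (Hex : forall z, (Cmod z < rho)%R ->
    exists l, ctends eventually (sum_n (fun n => A n * z ^ n)) l).
  { intros z Hz. pose proof (Cmod_ge_0 z).
    destruct (ex_series_C_le (fun n => A (S n) * z ^ n)
      (fun n => Rabs (Cmod (a n) * Cmod z ^ n))) as [l Hl].
    - intros n. rewrite Rabs_pos_eq, Cmod_mult, Cmod_pow.
      2:{ apply Rmult_le_pos; [apply Cmod_ge_0|apply pow_le; auto]. }
      apply Rmult_le_compat_r; [apply pow_le; auto|].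
      unfold A. rewrite Cmod_div, Cmod_R, Rabs_pos_eq by (apply Hn || apply pos_INR).
      assert (1 <= INR (S n))%R by (rewrite S_INR; pose proof (pos_INR n); lra).
      pose proof (Cmod_ge_0 (a n)).
      apply (Rmult_le_reg_r (INR (S n))); [lra|].
      unfold Rdiv. rewrite Rmult_assoc, Rinv_l by lra. nra.
    - apply (CV_disk_inside (fun n => Cmod (a n))). rewrite Rabs_pos_eq by lra.
      apply (pser_radius a h rho); auto.
    - exists (A O + z * l). apply ctends_eventually_S_inv.
      apply (ctends_ext (fun n => A O + z * sum_n (fun n => A (S n) * z ^ n) n)).
      + apply filter_forall. intros n. now rewrite sum_n_shift.
      + apply ctends_plus; [apply ctends_const|].
        apply ctends_mult; [apply ctends_const|exact Hl]. }
  (* Limits are unique, so definite description turns the pointwise sums into a function. *)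
  set (H := fun z => @iota C_CompleteNormedModule
    (fun l : C => ctends eventually (sum_n (fun n => A n * z ^ n)) l)).
  assert (HP : pser A H rho).
  { intros z Hz. destruct (Hex z Hz) as [l Hl].
    unfold H. apply (iota_correct (V := C_CompleteNormedModule)). exists l. split; [exact Hl|].
    intros m Hm. exact (ctends_unique _ _ _ Hl Hm). }
  exists H. intros z Hz.
  destruct (pser_derive_at A H rho z HP Hz) as [l [H1 H2]].
  replace (h z) with l; [exact H2|].
  apply (ctends_unique _ _ _ H1).
  apply (ctends_ext (sum_n (fun n => a n * z ^ n))); [|now apply Hp].
  apply filter_forall. intros n. apply sum_n_ext. intros k. unfold Dps, A.
  f_equal. field. apply Hn.
Qed.

(* Cauchy's bound for the powers [h ^ n]; the constant in it disappears after
   taking [n]-th roots. *)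
Lemma max_modulus (h : C -> C) (rho r M : R) (z0 : C) :
  (forall z, (Cmod z < rho)%R -> exists l, has_cderiv h z l) ->
  (Cmod z0 < r)%R -> (r < rho)%R -> (0 < M)%R ->
  (forall z, Cmod z = r -> (Cmod (h z) <= M)%R) -> (Cmod (h z0) <= M)%R.
Proof.
  intros Hh Hz Hr HM Hb. apply Rnot_lt_le. intros Hlt.
  set (B := (r / (r - Cmod z0))%R).
  assert (Hn : forall n, (Cmod (h z0) ^ n <= B * M ^ n)%R).
  { intros n. rewrite <- Cmod_pow.
    apply (cauchy_bound (fun z => h z ^ n) rho r); auto.
    - intros z Hz1. destruct (Hh z Hz1) as [l Hl]. exact (has_cderiv_pow _ _ _ n Hl).
    - intros z Hz1. rewrite Cmod_pow. apply pow_incr. split; [apply Cmod_ge_0|auto]. }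
  set (x := (Cmod (h z0) / M)%R).
  assert (Hx : (1 < x)%R).
  { unfold x. apply (Rmult_lt_reg_r M); [auto|]. unfold Rdiv.
    rewrite Rmult_assoc, Rinv_l; lra. }
  destruct (Pow_x_infinity x ltac:(rewrite Rabs_pos_eq; lra) (B + 1)%R) as [N HN].
  specialize (HN N (le_n N)). rewrite Rabs_pos_eq in HN by (apply pow_le; lra).
  specialize (Hn N).
  assert (HMN : (0 < M ^ N)%R) by now apply pow_lt.
  assert (E : (Cmod (h z0) ^ N = x ^ N * M ^ N)%R).
  { rewrite <- Rpow_mult_distr. f_equal. unfold x. field. lra. }
  rewrite E in Hn. apply Rmult_le_reg_r in Hn; lra.
Qed.

(** * Punctured neighbourhoods and poles *)

Definition punctured (z : C) (P : C -> Prop) : Prop :=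
  exists d : R, (0 < d)%R /\ forall y, (0 < Cmod (y - z) < d)%R -> P y.

(** Properness makes limits at a pole unique, whatever value the total function [f] takes there. *)
#[export] Instance punctured_proper (z : C) : ProperFilter (punctured z).
Proof.
  split; [|split].
  - intros P [d [Hd H]]. exists (z + RtoC (d / 2)). apply H.
    replace (z + RtoC (d / 2) - z) with (RtoC (d / 2)) by ring.
    rewrite Cmod_R, Rabs_pos_eq; lra.
  - exists 1%R. split; [lra|auto].
  - intros P Q [d [Hd HP]] [e [He HQ]]. exists (Rmin d e). split.
    + now apply Rmin_glb_lt.
    + intros y [Hy0 Hy].
      pose proof (Rmin_l d e). pose proof (Rmin_r d e).
      split; [apply HP|apply HQ]; lra.
  - intros P Q H [d [Hd HP]]. exists d; auto.
Qed.

Lemma cnbhs_punctured (z : C) (P : C -> Prop) : cnbhs z P -> punctured z P.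
Proof. intros [d [Hd H]]. exists d. split; [auto|]. intros y Hy. apply H. lra. Qed.

Lemma ctends_punctured (z : C) (h : C -> C) (l : C) :
  ctends (cnbhs z) h l -> ctends (punctured z) h l.
Proof. intros H eps He. now apply cnbhs_punctured, H. Qed.

Lemma punctured_neq (z : C) : punctured z (fun y => y <> z).
Proof.
  exists 1%R. split; [lra|]. intros y [Hy _] ->. rewrite Cmod_minus_self in Hy. lra.
Qed.

Lemma has_simple_pole_at_ctends (f : C -> C) (q : C) :
  has_simple_pole_at f q <->
  exists c : C, c <> 0 /\ ctends (punctured q) (fun z => (z - q) * f z) c.
Proof. split; intros [c [Hc H]]; exact (ex_intro _ c (conj Hc H)). Qed.

Lemma simple_pole_is_pole (f : C -> C) (q : C) : has_simple_pole_at f q -> has_pole_at f q.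
Proof.
  intros [c [Hc H]] M. assert (Hm : (0 < Cmod c)%R) by now apply Cmod_gt_0.
  destruct (H (Cmod c / 2)%R ltac:(lra)) as [d [Hd Hnear]].
  pose proof (Rabs_pos M) as HM. pose proof (Rle_abs M) as HM'.
  (* Near [q] the product of [Cmod (z - q)] and [Cmod (f z)] exceeds [Cmod c / 2]; [Rabs M + 1] is a
     positive bound above [M]. *)
  set (e := (Cmod c / 2 / (Rabs M + 1))%R).
  assert (He : (0 < e)%R) by (apply Rdiv_lt_0_compat; lra).
  exists (Rmin d e). split; [now apply Rmin_glb_lt|].
  intros z [Hz0 Hz]. pose proof (Rmin_l d e). pose proof (Rmin_r d e).
  specialize (Hnear z ltac:(lra)). rewrite Cmod_minus_sym in Hnear.
  pose proof (Cmod_triangle_rev c ((z - q) * f z)) as Ht. rewrite Cmod_mult in Ht.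
  assert (Hlow : (Cmod c / 2 < Cmod (z - q) * Cmod (f z))%R) by lra.
  assert (Hup : (Cmod (z - q) * (Rabs M + 1) < Cmod c / 2)%R).
  { replace (Cmod c / 2)%R with (e * (Rabs M + 1))%R by (unfold e; field; lra).
    apply Rmult_lt_compat_r; lra. }
  assert (Rabs M + 1 < Cmod (f z))%R by (apply (Rmult_lt_reg_l (Cmod (z - q))); lra).
  lra.
Qed.

(** * Integrals along segments of the disc *)

Lemma segment_in_D (z q : C) (s : R) : inD z -> inD q -> (0 <= s <= 1)%R ->
  inD (z + RtoC s * (q - z)).
Proof.
  unfold inD. intros Hz Hq Hs.
  replace (z + RtoC s * (q - z)) with (RtoC (1 - s) * z + RtoC s * q)
    by (rewrite RtoC_minus; ring).
  eapply Rle_lt_trans; [apply Cmod_triangle|].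
  rewrite !Cmod_mult, !Cmod_R, !Rabs_pos_eq by lra.
  destruct (Req_dec s 0) as [->|Hs0]; [lra|].
  assert (s * Cmod q < s * 1)%R by (apply Rmult_lt_compat_l; lra).
  assert ((1 - s) * Cmod z <= (1 - s) * 1)%R by (apply Rmult_le_compat_l; lra).
  lra.
Qed.

Lemma has_rderiv_segment (z q : C) (s : R) :
  has_rderiv (fun s => z + RtoC s * (q - z)) s (q - z).
Proof.
  apply (has_rderiv_ext (fun s => z + (q - z) * RtoC s) _ _ ((q - z) * 1)).
  - intros t. ring.
  - ring.
  - apply has_rderiv_affine, has_rderiv_RtoC.
Qed.

Lemma segment_integrand_cont (w : C -> C) (z q : C) : holo_on inD w -> inD z -> inD q ->
  cont_on (fun s => w (z + RtoC s * (q - z)) * (q - z)) 0 1.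
Proof.
  intros Hw Hz Hq s Hs. apply rcont_mult; [|apply rcont_const].
  destruct (Hw _ (segment_in_D z q s Hz Hq Hs)) as [l Hl].
  exact (rcont_comp w (fun s => z + RtoC s * (q - z)) s l Hl
    (has_rderiv_ctends _ _ _ (has_rderiv_segment z q s))).
Qed.

Lemma seg_int_primitive (w W : C -> C) (z q : C) : holo_on inD w ->
  (forall y, inD y -> has_cderiv W y (w y)) -> inD z -> inD q ->
  seg_int w z q = W q - W z.
Proof.
  intros Hw HW Hz Hq.
  change (CI (fun s => w (z + RtoC s * (q - z)) * (q - z)) 0 1 = W q - W z).
  rewrite (CI_deriv (fun s => W (z + RtoC s * (q - z)))).
  - f_equal; [|f_equal]; f_equal; ring.
  - lra.
  - intros s Hs. apply (has_rderiv_comp W); [|apply has_rderiv_segment].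
    apply HW. now apply segment_in_D.
  - now apply segment_integrand_cont.
Qed.

Lemma Cmod_seg_int_le (w : C -> C) (z q : C) : holo_on inD w ->
  (forall y, inD y -> (Cmod (w y) <= 1)%R) -> inD z -> inD q ->
  (Cmod (seg_int w z q) <= Cmod (q - z))%R.
Proof.
  intros Hw Hb Hz Hq.
  change (Cmod (CI (fun s => w (z + RtoC s * (q - z)) * (q - z))%C 0 1) <= Cmod (q - z))%R.
  replace (Cmod (q - z)) with ((1 - 0) * Cmod (q - z))%R by ring.
  apply Cmod_CI_le; [lra|now apply segment_integrand_cont|].
  intros s Hs. rewrite Cmod_mult. pose proof (Cmod_ge_0 (q - z)).
  specialize (Hb _ (segment_in_D z q s Hz Hq Hs)). nra.
Qed.

(** At 0 the equation [g z * f z = z] reads [0 = 0]; its derivative is what links [g 0] to [f'(0)].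
    It gives [g 0 = 1] in one direction and the coefficient [a 1 = 1] in the other. *)
Lemma deriv_at_0_of_mul_eq_id (g f : C -> C) (l m : C) :
  has_cderiv g 0 l -> has_cderiv f 0 m -> f 0 = 0 ->
  cnbhs 0 (fun z => g z * f z = z) -> g 0 * m = 1.
Proof.
  intros Hg Hf Hf0 Hgf.
  pose proof (has_cderiv_ext_loc _ _ _ _ Hgf (has_cderiv_mult _ _ _ _ _ Hg Hf)) as H.
  pose proof (has_cderiv_unique _ _ _ _ H (has_cderiv_id 0)) as E.
  rewrite Hf0 in E. rewrite <- E. ring.
Qed.

(** * The two directions of the equivalence *)

Section Main.

Variables (lam p : R) (f : C -> C).
Hypothesis Hlam : (0 < lam < 1)%R.
Hypothesis Hp : (0 < p < 1)%R.

Lemma p_in_D : inD (RtoC p).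
Proof. unfold inD. rewrite Cmod_R, Rabs_pos_eq; lra. Qed.

Lemma p_nz : RtoC p <> 0.
Proof. apply RtoC_nz. lra. Qed.

Lemma small_neq_p (z : C) : (Cmod z < p)%R -> z <> RtoC p.
Proof. intros H ->. rewrite Cmod_R, Rabs_pos_eq in H; lra. Qed.

Lemma cnbhs_0_small : cnbhs 0 (fun z => (Cmod z < p)%R).
Proof. apply cnbhs_disc. rewrite Cmod_0. lra. Qed.

Lemma Um_representation : in_Um lam p f -> has_simple_pole_at f (RtoC p) ->
  exists w : C -> C,
    holo_on inD w /\
    (forall z, inD z -> (Cmod (w z) <= 1)%R) /\
    (forall z, inD z -> z <> RtoC p ->
       f z = z / (1 - z / RtoC p + RtoC lam * z * seg_int w z (RtoC p))).
Proof.
  intros (_ & _ & (a & Ha0 & Ha1 & Ha) & (g & g' & Hg & Hgf & HU)) Hpole.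
  pose proof p_in_D as HpD. pose proof p_nz as Hpn.
  assert (Hln : RtoC lam <> 0) by (apply RtoC_nz; lra).
  assert (Hf : pser a f p) by (intros z Hz; apply is_series_ctends, Ha, Hz).
  assert (Hf0 : f 0 = 0) by (rewrite (pser_0 a f p); auto; lra).
  destruct (taylor g 1 Rlt_0_1) as [b Hb].
  { intros z Hz. exists (g' z). now apply Hg. }
  assert (H0D : inD 0) by (unfold inD; rewrite Cmod_0; lra).
  assert (Hg0 : g 0 = 1).
  { destruct (pser_derive _ _ _ Hf) as [Hf1 Hf2].
    assert (E : C_derive f 0 = 1).
    { rewrite (pser_0 _ _ _ (proj1 Hp) Hf1). unfold Dps. rewrite Ha1. simpl. ring. }
    rewrite <- (Cmult_1_r (g 0)). rewrite <- E at 1.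
    apply (deriv_at_0_of_mul_eq_id g f (g' 0)); auto.
    - apply Hf2. rewrite Cmod_0. lra.
    - generalize cnbhs_0_small. apply filter_imp. intros z Hz.
      apply Hgf; [unfold inD; lra|now apply small_neq_p]. }
  assert (Hb0 : b O = 1) by (rewrite <- Hg0; symmetry; apply (pser_0 b g 1); auto; lra).
  assert (Hgp : g (RtoC p) = 0).
  { apply has_simple_pole_at_ctends in Hpole. destruct Hpole as [c [Hc Tc]].
    (* The same function equals [z * (z - p)] near [p] and so tends to 0; since [c] is nonzero,
       [g p] vanishes. *)
    assert (T1 : ctends (punctured (RtoC p)) (fun z => g z * ((z - RtoC p) * f z)) (g (RtoC p) * c)).
    { apply ctends_mult; [|exact Tc]. apply ctends_punctured.
      exact (has_cderiv_ctends _ _ _ (Hg _ HpD)). }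
    assert (T2 : ctends (punctured (RtoC p)) (fun z => g z * ((z - RtoC p) * f z)) 0).
    { apply (ctends_ext (fun z => z * (z - RtoC p))).
      - generalize (filter_and _ _ (punctured_neq (RtoC p))
          (cnbhs_punctured _ _ (cnbhs_disc (RtoC p) 1 HpD))).
        apply filter_imp. intros z [Hz1 Hz2].
        replace (g z * ((z - RtoC p) * f z)) with ((g z * f z) * (z - RtoC p)) by ring.
        now rewrite Hgf.
      - replace (RtoC 0) with (RtoC p * (RtoC p - RtoC p)) by ring.
        apply ctends_punctured, ctends_mult; [apply ctends_id|].
        apply ctends_minus; [apply ctends_id|apply ctends_const]. }
    pose proof (ctends_unique _ _ _ T1 T2) as E.
    destruct (Ceq_dec (g (RtoC p)) 0) as [|N]; [auto|].
    elim (Cmult_neq_0 _ _ N Hc E). }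
  destruct (pser_quotient b g 1 Hb) as [k [Hk1 Hk2]]. rewrite Hb0 in Hk2.
  destruct (pser_derive _ _ _ Hk1) as [Hk3 Hk4].
  destruct (pser_derive _ _ _ Hk3) as [_ Hk5].
  set (k' := C_derive k) in *.
  assert (HU' : forall z, inD z -> g z - z * g' z - 1 = - (z * z * k' z)).
  { intros z Hz.
    assert (E : g' z = 0 + (1 * k z + z * k' z)).
    { apply (has_cderiv_unique g z); [now apply Hg|].
      apply (has_cderiv_ext_loc (fun z => 1 + z * k z)).
      - generalize (cnbhs_disc z 1 Hz). apply filter_imp. intros y Hy. now rewrite Hk2.
      - apply has_cderiv_plus; [apply has_cderiv_const|].
        apply has_cderiv_mult; [apply has_cderiv_id|now apply Hk4]. }
    rewrite E, Hk2 by auto. ring. }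
  exists (fun z => - / RtoC lam * k' z).
  assert (Hholo : holo_on inD (fun z => - / RtoC lam * k' z)).
  { intros z Hz. eexists. apply has_cderiv_scal. now apply Hk5. }
  split; [exact Hholo|]. split.
  - intros z Hz. unfold inD in Hz. pose proof (Cmod_ge_0 z) as Hz0.
    assert (Hr : forall r, (Cmod z < r < 1)%R -> (r * r * Cmod (k' z) <= lam)%R).
    { intros r Hr. assert (Hrr : (0 < r * r)%R) by (apply Rmult_lt_0_compat; lra).
      assert (Hle : (Cmod (k' z) <= lam / (r * r))%R).
      { apply (max_modulus k' 1 r); try lra.
        - intros y Hy. eexists. now apply Hk5.
        - apply Rdiv_lt_0_compat; lra.
        - intros y Hy. specialize (HU y). rewrite HU' in HU by (unfold inD; lra).
          rewrite Cmod_opp, !Cmod_mult, Hy in HU. specialize (HU ltac:(unfold inD; lra)).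
          apply (Rmult_le_reg_l (r * r)); [auto|].
          replace (r * r * (lam / (r * r)))%R with lam by (field; lra). lra. }
      apply (Rmult_le_compat_l (r * r)) in Hle; [|lra].
      replace (r * r * (lam / (r * r)))%R with lam in Hle by (field; lra). auto. }
    assert (Hk : (Cmod (k' z) <= lam)%R).
    { apply Rnot_lt_le. intros Hlt. set (X := Cmod (k' z)) in *.
      (* The first bound keeps [z] inside the circle of radius [1 - e]. The second makes [2 * e * X]
         at most [(X - lam) / 2], so [(1 - e) ^ 2 * X] would still exceed [lam]. *)
      set (e := Rmin ((1 - Cmod z) / 2) ((X - lam) / (4 * X))%R).
      assert (E1 : (e <= (1 - Cmod z) / 2)%R) by apply Rmin_l.
      assert (E2 : (e <= (X - lam) / (4 * X))%R) by apply Rmin_r.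
      assert (E3 : (0 < e)%R).
      { apply Rmin_glb_lt; [lra|]. apply Rdiv_lt_0_compat; lra. }
      assert (E4 : (e * X <= (X - lam) / 4)%R).
      { apply (Rmult_le_compat_r X) in E2; [|lra].
        replace ((X - lam) / (4 * X) * X)%R with ((X - lam) / 4)%R in E2 by (field; lra). auto. }
      specialize (Hr (1 - e)%R ltac:(lra)).
      assert (0 <= e * e * X)%R by (apply Rmult_le_pos; [nra|lra]).
      lra. }
    rewrite Cmod_mult, Cmod_opp, Cmod_inv, Cmod_R, Rabs_pos_eq by (auto || lra).
    apply (Rmult_le_reg_l lam); [lra|]. rewrite <- Rmult_assoc, Rinv_r by lra. lra.
  - intros z Hz Hzp.
    rewrite (seg_int_primitive _ (fun z => - / RtoC lam * k z)); auto.
    2:{ intros y Hy. apply has_cderiv_scal. now apply Hk4. }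
    (* This value of [k] is the source of the term [- z / p] in the denominator. *)
    assert (Ekp : k (RtoC p) = - / RtoC p).
    { pose proof (Hk2 _ HpD) as E. rewrite Hgp in E.
      replace (k (RtoC p)) with ((1 + RtoC p * k (RtoC p) - 1) / RtoC p) by (field; auto).
      rewrite <- E. field. auto. }
    replace (1 - z / RtoC p + RtoC lam * z * (- / RtoC lam * k (RtoC p) - - / RtoC lam * k z))
      with (g z).
    2:{ rewrite Hk2, Ekp by auto. field. auto. }
    specialize (Hgf z Hz Hzp).
    (* Away from 0 the relation [g z * f z = z] excludes [g z = 0]; at 0 it does not, and both sides
       are evaluated. *)
    destruct (Ceq_dec z 0) as [->|Nz].
    + rewrite Hf0, Hg0. field.
    + assert (g z <> 0) by (intros E; rewrite E, Cmult_0_l in Hgf; congruence).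
      rewrite <- Hgf at 2. field. auto.
Qed.

Lemma representation_Um (w : C -> C) :
  holo_on inD w -> (forall z, inD z -> (Cmod (w z) <= 1)%R) ->
  (forall z, inD z -> z <> RtoC p ->
     f z = z / (1 - z / RtoC p + RtoC lam * z * seg_int w z (RtoC p))) ->
  in_Um lam p f /\ has_simple_pole_at f (RtoC p).
Proof.
  intros Hw Hb Hf.
  pose proof p_in_D as HpD. pose proof p_nz as Hpn.
  assert (H0D : inD 0) by (unfold inD; rewrite Cmod_0; lra).
  destruct (taylor w 1 Rlt_0_1 Hw) as [a Ha].
  destruct (pser_primitive a w 1 Ha) as [W HW].
  (* Replacing the segment integral by a difference of primitives makes the denominator visibly
     differentiable on the whole disc, [p] included. *)
  set (g := fun z => 1 - z / RtoC p + RtoC lam * (z * (W (RtoC p) - W z))).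
  set (g' := fun z => 0 - 1 * / RtoC p + RtoC lam * (1 * (W (RtoC p) - W z) + z * (0 - w z))).
  assert (Eg : forall z, inD z ->
    1 - z / RtoC p + RtoC lam * z * seg_int w z (RtoC p) = g z).
  { intros z Hz. rewrite (seg_int_primitive w W) by auto. unfold g. ring. }
  assert (Hg : forall z, inD z -> has_cderiv g z (g' z)).
  { intros z Hz. apply has_cderiv_plus.
    - apply has_cderiv_minus; [apply has_cderiv_const|].
      pose proof (has_cderiv_scal (/ RtoC p) _ z 1 (has_cderiv_id z)) as H.
      rewrite Cmult_comm in H. revert H. apply has_cderiv_ext_loc.
      apply filter_forall. intros y. unfold Cdiv. ring.
    - apply has_cderiv_scal.
      apply (has_cderiv_mult (fun y => y) (fun y => W (RtoC p) - W y)); [apply has_cderiv_id|].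
      apply has_cderiv_minus; [apply has_cderiv_const|now apply HW]. }
  assert (Hgp : g (RtoC p) = 0) by (unfold g; field; auto).
  assert (Hg0 : g 0 = 1) by (unfold g; field; auto).
  assert (Hgn : forall z, inD z -> z <> RtoC p -> g z <> 0).
  { intros z Hz Hzp E. rewrite <- Eg in E by auto.
    set (S := seg_int w z (RtoC p)) in *.
    assert (E' : RtoC p - z = - (RtoC lam * RtoC p * z * S)).
    { replace (RtoC p - z) with
        (RtoC p * (1 - z / RtoC p + RtoC lam * z * S) - RtoC lam * RtoC p * z * S)
        by (field; auto).
      rewrite E. ring. }
    assert (HS : (Cmod S <= Cmod (RtoC p - z))%R) by now apply Cmod_seg_int_le.
    assert (Hpos : (0 < Cmod (RtoC p - z))%R).
    { apply Cmod_gt_0, Cminus_eq_contra. auto. }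
    apply (f_equal Cmod) in E'.
    rewrite Cmod_opp, !Cmod_mult, !Cmod_R, !Rabs_pos_eq in E' by lra.
    unfold inD in Hz. pose proof (Cmod_ge_0 z).
    assert (Hlp : (0 < lam * p < 1)%R) by (split; nra).
    assert (Hlz : (0 <= lam * p * Cmod z < 1)%R) by (split; nra).
    nra. }
  assert (Hfg : forall z, inD z -> z <> RtoC p -> f z = z / g z).
  { intros z Hz Hzp. now rewrite Hf, Eg. }
  assert (Hgf : forall z, inD z -> z <> RtoC p -> g z * f z = z).
  { intros z Hz Hzp. rewrite Hfg by auto. field. auto. }
  assert (Hholo : holo_on (fun z => inD z /\ z <> RtoC p) f).
  { intros z [Hz Hzp]. eexists.
    apply (has_cderiv_ext_loc (fun y => y * / g y)).
    - generalize (filter_and _ _ (cnbhs_disc z 1 Hz) (cnbhs_neq z (RtoC p) Hzp)).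
      apply filter_imp. intros y [Hy1 Hy2]. symmetry. now apply Hfg.
    - apply has_cderiv_mult; [apply has_cderiv_id|].
      apply has_cderiv_inv; [now apply Hgn|now apply Hg]. }
  assert (Hsp : has_simple_pole_at f (RtoC p)).
  { apply has_simple_pole_at_ctends.
    (* A zero would give [1 = - lam p^2 w(p)], whose right-hand side has modulus below 1. *)
    assert (Hg'p : g' (RtoC p) <> 0).
    { intros E.
      assert (E' : RtoC 1 = - (RtoC lam * RtoC p * RtoC p * w (RtoC p))).
      { replace (RtoC 1) with (- (RtoC p * g' (RtoC p))
          - RtoC lam * RtoC p * RtoC p * w (RtoC p)) by (unfold g'; field; auto).
        rewrite E. ring. }
      apply (f_equal Cmod) in E'.
      rewrite Cmod_opp, !Cmod_mult, !Cmod_R, !(Rabs_pos_eq p), (Rabs_pos_eq lam), Rabs_R1 in E' by lra.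
      specialize (Hb _ HpD). pose proof (Cmod_ge_0 (w (RtoC p))).
      assert (Hlp : (0 < lam * p < 1)%R) by (split; nra).
      assert (Hlpp : (0 < lam * p * p < 1)%R) by (split; nra).
      nra. }
    pose proof (Hg _ HpD) as Hd. apply has_cderiv_slope in Hd.
    destruct Hd as [phi [_ [Tphi Hphi]]].
    exists (RtoC p / g' (RtoC p)). split.
    - intros E. apply Hpn. replace (RtoC p) with (RtoC p / g' (RtoC p) * g' (RtoC p)) by (field; auto).
      rewrite E. ring.
    (* Because [g p = 0], the slope form reads [g z = (z - p) * phi z], so the factor [z - p]
       cancels and the limit is [p / g' p]. *)
    - apply (ctends_ext (fun z => z / phi z)).
      + generalize (filter_and _ _ (punctured_neq (RtoC p))
          (cnbhs_punctured _ _ (cnbhs_disc (RtoC p) 1 HpD))).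
        apply filter_imp. intros z [Hz1 Hz2]. rewrite (Hfg z Hz2 Hz1).
        pose proof (Hgn z Hz2 Hz1) as Nz. rewrite Hphi, Hgp in Nz |- *.
        rewrite Cplus_0_l in Nz |- *.
        assert (phi z <> 0) by (intros E; apply Nz; rewrite E; ring).
        field. split; [auto|now apply Cminus_eq_contra].
      + apply ctends_punctured, ctends_div; auto. apply ctends_id. }
  split; [|exact Hsp]. split; [exact Hholo|]. split; [now apply simple_pole_is_pole|]. split.
  - assert (Hh : forall z, (Cmod z < p)%R -> exists l, has_cderiv f z l).
    { intros z Hz. apply Hholo. split; [unfold inD; lra|now apply small_neq_p]. }
    destruct (taylor f p (proj1 Hp) Hh) as [c Hc].
    assert (Hf0 : f 0 = 0).
    { rewrite Hfg; [rewrite Hg0; field|auto|]. apply small_neq_p. rewrite Cmod_0. lra. }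
    exists c. split; [|split].
    + rewrite <- Hf0. symmetry. apply (pser_0 c f p); auto. lra.
    + destruct (pser_derive _ _ _ Hc) as [Hc1 Hc2].
      pose proof (pser_0 _ _ _ (proj1 Hp) Hc1) as E. unfold Dps in E.
      assert (E1 : g 0 * C_derive f 0 = 1).
      { apply (deriv_at_0_of_mul_eq_id g f (g' 0)); auto.
        - apply Hc2. rewrite Cmod_0. lra.
        - generalize cnbhs_0_small. apply filter_imp. intros z Hz.
          apply Hgf; [unfold inD; lra|now apply small_neq_p]. }
      rewrite Hg0, E in E1. rewrite <- E1. simpl. ring.
    + intros z Hz. now apply is_series_ctends, Hc.
  - exists g, g'. split; [exact Hg|]. split; [exact Hgf|].
    intros z Hz.
    replace (g z - z * g' z - 1) with (RtoC lam * (z * z * w z))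
      by (unfold g, g'; field; auto).
    (* The bound on [w] is not strict; strictness comes from [|z|^2 < 1]. *)
    rewrite !Cmod_mult, Cmod_R, Rabs_pos_eq by lra.
    specialize (Hb z Hz). unfold inD in Hz.
    pose proof (Cmod_ge_0 z). pose proof (Cmod_ge_0 (w z)).
    assert (Cmod z * Cmod z < 1)%R by nra.
    assert (0 <= Cmod z * Cmod z)%R by nra.
    assert (Cmod z * Cmod z * Cmod (w z) < 1)%R by nra.
    nra.
Qed.

End Main.

Theorem theorem1 (lam p : R) (f : C -> C) :
  (0 < lam < 1)%R -> (0 < p < 1)%R ->
  ((in_Um lam p f /\ has_simple_pole_at f (RtoC p)) <->
   (exists w : C -> C,
      holo_on inD w /\
      (forall z, inD z -> (Cmod (w z) <= 1)%R) /\
      (forall z, inD z -> z <> RtoC p ->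
         f z = z / (1 - z / RtoC p + RtoC lam * z * seg_int w z (RtoC p))))).
Proof.
  intros Hlam Hp. split.
  - intros [H1 H2]. now apply Um_representation.
  - intros [w [H1 [H2 H3]]]. now apply (representation_Um lam p f Hlam Hp w).
Qed.
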